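(* Let $m\ge 2$ be an integer, and let $f\in H^m([0,1])$ be such that $f'(x)>0$ for all $x\in[0,1]$. Define $\phi_t(x)=tf(x)+(1-t)x$ for all $t\in[0,1]$ and $x\in[0,1]$. Then there exists a time-dependent vector field $(v_t^f)_{t\in[0,1]}$, depending on $f$, such that $v_t^f\in\mathcal{H}^m(\mathbb{R})$ for all $t\in[0,1]$ and which satisfies $\phi_1=\phi_0+\int_0^1 v_t^f(\phi_t)\,dt$, and thus $$f(x)=\phi_1(x)=x+\int_0^1 v_t^f(\phi_t(x))\,dt ,\qquad x\in[0,1].$$ Moreover, for all $t\in[0,1]$, $$v_t^f(\phi_t(x))=v_t^f\big(tf(x)+(1-t)x\big)=f(x)-x=\frac{d\phi_t}{dt}(x)\quad\text{for all }x\in[0,1].\qquad( * )$$ For all $t\in[0,1]$, the function $v_t^f$ can be chosen as the unique element of minimal norm in $\mathcal{H}^m(\mathbb{R})$ which satisfies $( * )$.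
   Context: $H^m([0,1])$ is the set of functions $f:[0,1]\to\mathbb{R}$ such that $f^{(m-1)}$ is absolutely continuous with $\int_0^1|f^{(m)}(x)|^2dx<+\infty$. $\mathcal{H}^m(\mathbb{R})$ is the Sobolev space of order $m$ on $\mathbb{R}$ (a reproducing kernel Hilbert space) endowed with the norm $\|h\|_{\mathcal{H}^m}^2=\int_{-\infty}^{+\infty}|h(x)|^2dx+\int_{-\infty}^{+\infty}|h^{(m)}(x)|^2dx$. The ambient space in which vector fields take values is $\tilde{\mathcal{H}}=\mathrm{Span}\{1,x\}+\mathcal{H}^m(\mathbb{R})$; a time-dependent vector field is a family $(v_t)_{t\in[0,1]}$ with $v_t\in\tilde{\mathcal{H}}$ for all $t\in[0,1]$. *)

(* Defs.v *)
From mathcomp Require Export all_boot all_order all_algebra.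
From mathcomp Require Export all_classical all_reals all_analysis.

Set Implicit Arguments.
Unset Strict Implicit.
Unset Printing Implicit Defensive.

Import Order.TTheory GRing.Theory Num.Theory.
Import numFieldNormedType.Exports.

Local Open Scope classical_set_scope.
Local Open Scope ring_scope.

(* Derivatives relative to a set [A].  For [A = `[a, b]] they are one-sided at
   the endpoints, so that they only depend on the values of [f] on [A]; a
   function on [A] is represented by a function [R -> R] whose values outside
   [A] are irrelevant. *)
Definition diff_quot (R : realType) (f : R -> R) (x y : R) : R :=
  (f y - f x) / (y - x).

Definition derivable_in (R : realType) (A : set R) (f : R -> R) (x : R) : Prop :=
  cvg (diff_quot f x y @[y --> within A x^']).

Definition derive_in (R : realType) (A : set R) (f : R -> R) (x : R) : R :=
  lim (diff_quot f x y @[y --> within A x^']).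

Definition deriven_in (R : realType) (A : set R) (k : nat) (f : R -> R) : R -> R :=
  iter k (derive_in A) f.

Definition abs_continuous (R : realType) (a b : R) (f : R -> R) : Prop :=
  forall e : R, 0 < e -> exists2 d : R, 0 < d &
    forall (n : nat) (x y : 'I_n -> R),
      (forall i, a <= x i /\ x i < y i /\ y i <= b) ->
      trivIset [set: 'I_n] (fun i => `]x i, y i[%classic) ->
      \sum_(i < n) (y i - x i) < d ->
      \sum_(i < n) `|f (y i) - f (x i)| < e.

Definition sq_integrable (R : realType) (A : set R) (g : R -> R) : Prop :=
  measurable_fun A g /\
  (\int[lebesgue_measure]_(x in A) (`|g x| ^+ 2)%:E < +oo)%E.

(* In the two spaces below the derivative of order [m] only exists almost
   everywhere; at the remaining points [deriven_in] and [derive1n] take the default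
   value of [lim], which does not affect the integrals. *)
Definition sobolev01 (R : realType) (m : nat) : set (R -> R) :=
  [set f | [/\ forall k : nat, (k < m.-1)%N -> forall x : R, x \in `[0, 1] ->
                 derivable_in `[0, 1] (deriven_in `[0, 1] k f) x,
               abs_continuous 0 1 (deriven_in `[0, 1] m.-1 f) &
               sq_integrable `[0, 1] (deriven_in `[0, 1] m f)]].

Arguments sobolev01 : clear implicits.

(* Elements are the [C^(m-1)] representatives, hence genuine functions. *)
Definition sobolevR (R : realType) (m : nat) : set (R -> R) :=
  [set h | [/\ forall k : nat, (k < m.-1)%N -> forall x : R, derivable (derive1n k h) x 1,
               forall a b : R, a < b -> abs_continuous a b (derive1n m.-1 h) &
               forall k : nat, (k <= m)%N -> sq_integrable setT (derive1n k h)]].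

Arguments sobolevR : clear implicits.

Definition sobolev_norm (R : realType) (m : nat) (h : R -> R) : R :=
  Num.sqrt (\int[lebesgue_measure]_(x in [set: R]) (`|h x| ^+ 2) +
            \int[lebesgue_measure]_(x in [set: R]) (`|derive1n m h x| ^+ 2)).

(* [Span {1, x} + H^m(R)] *)
Definition sobolevR_affine (R : realType) (m : nat) : set (R -> R) :=
  [set g | exists a b : R, exists2 h : R -> R,
             h \in sobolevR R m & forall x : R, g x = a + b * x + h x].

Arguments sobolevR_affine : clear implicits.

(* Only the times [t] in [[0, 1]] matter. *)
Definition vector_field (R : realType) (m : nat) (v : R -> R -> R) : Prop :=
  forall t : R, t \in `[0, 1] -> v t \in sobolevR_affine R m.

Definition min_norm_elt (R : realType) (m : nat) (S : set (R -> R)) (u : R -> R)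
    : Prop :=
  u \in S /\ forall w : R -> R, w \in S -> sobolev_norm m u <= sobolev_norm m w.

Definition phi (R : realType) (f : R -> R) (t x : R) : R := t * f x + (1 - t) * x.

Definition interpolates (R : realType) (f : R -> R) (t : R) (w : R -> R) : Prop :=
  forall x : R, x \in `[0, 1] -> w (phi f t x) = f x - x.

(* Main.v *)
(* Fix t. Since phi_t is an increasing bijection of [0, 1] onto some [a, b] with
   derivative bounded below, the prescribed values g = (f - id) o phi_t^-1 lie in
   H^m([a, b]). The minimizer is explicit: extend g to the right of b and to the left
   of a by the decaying solutions of u^(2m) = (-1)^(m+1) u which match the derivatives
   of g of order < m at b and at a. Any competitor is u + z with z = 0 on [a, b], and
   integrating by parts on the two half-lines gives
     int_R (u z + u^(m) z^(m)) = 0,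
   so that |u + z|^2 = |u|^2 + |z|^2: this yields minimality and uniqueness at once,
   without completeness of L^2. *)

From HB Require Import structures.
Require Import Defs.
From mathcomp Require Import all_boot all_order all_algebra.
From mathcomp Require Import all_classical all_reals all_analysis.
From mathcomp Require Import ring lra measurable_realfun complex.
Import Order.TTheory GRing.Theory Num.Theory.
Import numFieldNormedType.Exports.

Set Implicit Arguments.
Unset Strict Implicit.
Unset Printing Implicit Defensive.

Local Open Scope classical_set_scope.
Local Open Scope ring_scope.

(** The equation of the tails is the Euler-Lagrange equation [u + (-1)^m u^(2m) = 0] of the squared
    norm. Exactly [m] of its [2m] exponential solutions decay at [+oo], as many as there are
    derivatives to match at [b]. The derivative of order [m] exists only almost everywhere, and this
    shapes the rest. That [g] is in [H^m([a, b])] rests on F. Riesz's description of absolutely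
    continuous functions with square integrable derivative, which speaks of increments only:
    products, reciprocals and reparametrizations reduce to elementary inequalities. Integration by
    parts rests on the fundamental theorem of calculus for absolutely continuous functions, obtained
    from Radon-Nikodym and Lebesgue's differentiation theorem. The boundary term at infinity is
    handled without pointwise decay of the competitor: as a sum of products of square integrable
    functions it is integrable, and it converges, so its limit is [0]. *)

Section real_valued_integrable.
Context {R : realType}.
Notation mu := (@lebesgue_measure R).
Variables (A : set R) (mA : measurable A).
Implicit Types f g : R -> R.

Lemma integrable_EFinB f g : mu.-integrable A (EFin \o f) ->
  mu.-integrable A (EFin \o g) -> mu.-integrable A (EFin \o (fun x => f x - g x)).
Proof. exact: integrableB. Qed.

Lemma integrable_EFinD f g : mu.-integrable A (EFin \o f) ->
  mu.-integrable A (EFin \o g) -> mu.-integrable A (EFin \o (fun x => f x + g x)).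
Proof. exact: integrableD. Qed.

Lemma integrable_EFinZ (c : R) f : mu.-integrable A (EFin \o f) ->
  mu.-integrable A (EFin \o (fun x => c * f x)).
Proof. exact: integrableZl. Qed.

Lemma integrable_EFin_restrict f : mu.-integrable A (EFin \o f) ->
  mu.-integrable setT (EFin \o (f \_ A)).
Proof.
by move/(integrable_mkcond (mu := mu) (D := A) (EFin \o f) mA).1; rewrite restrict_EFin.
Qed.

End real_valued_integrable.

Lemma integrable_itvS (R : realType) (i j : interval R) (f : R -> R) :
  [set` j] `<=` [set` i] ->
  (@lebesgue_measure R).-integrable [set` i] (EFin \o f) ->
  (@lebesgue_measure R).-integrable [set` j] (EFin \o f).
Proof. by move=> ji; apply: integrableS => //; exact: measurable_itv. Qed.

Lemma lebesgue_measure_itv_bounded (R : realType) (b1 b2 : bool) (x y : R) : x <= y ->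
  (@lebesgue_measure R [set` Interval (BSide b1 x) (BSide b2 y)] = (y - x)%:E)%E.
Proof.
move=> xy; rewrite lebesgue_measure_itv/= lte_fin; case: ltP => // yx.
by rewrite (le_anti (introT andP (conj xy yx))) subrr.
Qed.

Lemma Rintegral_cst_itv (R : realType) (b1 b2 : bool) (x y c : R) : x <= y ->
  \int[@lebesgue_measure R]_(t in [set` Interval (BSide b1 x) (BSide b2 y)]) c = c * (y - x).
Proof.
move=> xy; rewrite Rintegral_cst; last exact: measurable_itv.
congr (_ * _); by rewrite [X in fine X](lebesgue_measure_itv_bounded b1 b2 xy).
Qed.

Lemma integrable_EFinS (R : realType) (A B : set R) (f : R -> R) :
  measurable A -> measurable B -> B `<=` A ->
  (@lebesgue_measure R).-integrable A (EFin \o f) ->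
  (@lebesgue_measure R).-integrable B (EFin \o f).
Proof. by move=> mA mB BA; apply: integrableS. Qed.

(** * Absolute continuity through finite families of intervals *)

Section absolute_continuity.
Context {R : realType}.
Implicit Types (a b p q : R) (F G : R -> R).

(* Unlike in [abs_continuous], the intervals may be degenerate and may be indexed by
   any finite type, which makes the class easy to handle under composition. *)
Definition ac_families a b F : Prop :=
  forall e : R, 0 < e -> exists2 d : R, 0 < d &
    forall (I : finType) (A : pred I) (x y : I -> R),
      (forall i, A i -> [/\ a <= x i, x i <= y i & y i <= b]) ->
      (forall i j, A i -> A j -> i != j -> y i <= x j \/ y j <= x i) ->
      \sum_(i | A i) (y i - x i) < d ->
      \sum_(i | A i) `|F (y i) - F (x i)| < e.

(** Otherwise the midpoint between the larger left end and the smaller right end would lie in both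
    intervals. *)
Lemma disjoint_itvoo_le (x1 y1 x2 y2 : R) : x1 < y1 -> x2 < y2 ->
  `]x1, y1[%classic `&` `]x2, y2[%classic = set0 -> y1 <= x2 \/ y2 <= x1.
Proof.
move=> xy1 xy2; apply: contra_eqP => /not_orP[/negP + /negP].
rewrite -!ltNge => x2y1 x1y2; apply/set0P.
exists ((Num.max x1 x2 + Num.min y1 y2) / 2).
have h : Num.max x1 x2 < Num.min y1 y2 by rewrite gt_max !lt_min xy1 x2y1 x1y2.
have h1 : x1 <= Num.max x1 x2 by rewrite le_max lexx.
have h2 : x2 <= Num.max x1 x2 by rewrite le_max lexx orbT.
have h3 : Num.min y1 y2 <= y1 by rewrite ge_min lexx.
have h4 : Num.min y1 y2 <= y2 by rewrite ge_min lexx orbT.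
by split; rewrite /= in_itv/=; apply/andP; split; lra.
Qed.

(** Degenerate intervals add nothing to either sum, so a family is replaced by its nondegenerate
    members, renumbered by an ordinal. *)
Lemma abs_continuousP a b F : abs_continuous a b F <-> ac_families a b F.
Proof.
split=> acF e /acF[d d0 dF]; exists d => //; last first.
  move=> n x y xy tI sd; apply: (dF 'I_n predT) => // [i _|i j _ _ ij].
    by have [? [/ltW ? ?]] := xy i.
  have [xi [xyi yi]] := xy i; have [xj [xyj yj]] := xy j.
  by apply: disjoint_itvoo_le => //; move/trivIsetP : tI; apply.
move=> I A x y xy dis sd.
pose B := [pred i | A i & x i < y i].
have xB i : A i -> ~~ (x i < y i) -> y i = x i.
  by move=> /xy[_ xyi _]; rewrite -leNgt => yx; apply/eqP; rewrite eq_le yx.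
have sB (h : R -> R -> R) : (forall u, h u u = 0) ->
    \sum_(i | A i) h (y i) (x i) =
    \sum_(j < #|B|) h (y (enum_val j)) (x (enum_val j)).
  move=> h0; rewrite (bigID (fun i => x i < y i))/= [X in _ + X]big1 ?addr0.
    exact: (big_enum_val (A := B) (fun i => h (y i) (x i))).
  by move=> i /andP[Ai nxy]; rewrite (xB i)// h0.
rewrite (sB (fun u v => `|F u - F v|)); last by move=> u; rewrite subrr normr0.
apply: dF.
- move=> j; have /andP[/xy[? ? ?] ?] := enum_valP j; by [].
- apply/trivIsetP => i j _ _ ij; apply: contraPP (dis (enum_val i) (enum_val j)).
  move=> /eqP/set0P[z [/=]]; rewrite !in_itv/= => /andP[z1 z2] /andP[z3 z4].
  have /andP[Ai _] := enum_valP i; have /andP[Aj _] := enum_valP j.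
  have ij' : enum_val i != enum_val j by apply: contra ij => /eqP/enum_val_inj ->.
  by move=> /(_ Ai Aj ij')[]; apply/negP; rewrite -ltNge; lra.
- by rewrite -(sB (fun u v => u - v))// => u; rewrite subrr.
Qed.

Lemma ac_familiesD a b F G :
  ac_families a b F -> ac_families a b G -> ac_families a b (F \+ G).
Proof.
move=> acF acG e e0; have e2 : 0 < e / 2 by rewrite divr_gt0.
have [d1 d10 dF] := acF _ e2; have [d2 d20 dG] := acG _ e2.
exists (Num.min d1 d2); first by rewrite lt_min d10.
move=> I A x y xy dis; rewrite lt_min => /andP[sd1 sd2].
have h1 := dF I A x y xy dis sd1; have h2 := dG I A x y xy dis sd2.
apply: (@le_lt_trans _ _ (\sum_(i | A i) `|F (y i) - F (x i)| +
  \sum_(i | A i) `|G (y i) - G (x i)|)); last by lra.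
rewrite -big_split/=; apply: ler_sum => i _.
by rewrite opprD addrACA; exact: ler_normD.
Qed.

Lemma ac_familiesZ a b (c : R) F :
  ac_families a b F -> ac_families a b (fun x => c * F x).
Proof.
move=> acF e e0; have c1 : 0 < `|c| + 1 by rewrite ltr_wpDl.
have [d d0 dF] := acF (e / (`|c| + 1)) (divr_gt0 e0 c1).
exists d => // I A x y xy dis sd.
have := dF I A x y xy dis sd; rewrite ltr_pdivlMr// => /le_lt_trans; apply.
rewrite mulrC mulr_sumr; apply: ler_sum => i _.
by rewrite -mulrBr normrM ler_wpM2r// lerDl.
Qed.

Lemma ac_families_lipschitz a b F (K : R) :
  (forall x y, a <= x -> x <= y -> y <= b -> `|F y - F x| <= K * (y - x)) ->
  ac_families a b F.
Proof.
(* The sign of [K] is not known; [|K| + 1] is positive and dominates it. *)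
move=> lF e e0; have K1 : 0 < `|K| + 1 by rewrite ltr_wpDl.
exists (e / (`|K| + 1)); first exact: divr_gt0.
move=> I A x y xy dis; rewrite ltr_pdivlMr// => /le_lt_trans; apply.
rewrite mulrC mulr_sumr; apply: ler_sum => i /xy[h1 h2 h3].
apply: (le_trans (lF _ _ h1 h2 h3)); apply: ler_wpM2r; first by rewrite subr_ge0.
by rewrite (le_trans (ler_norm _))// lerDl.
Qed.

(** [psi] carries a family to a family whose total length grows at most by the factor [L]. It need
    not be injective, so image intervals may be degenerate. *)
Lemma ac_families_comp a b p q F (psi : R -> R) (L : R) : 0 < L ->
  (forall x, p <= x -> x <= q -> a <= psi x <= b) ->
  (forall x y, p <= x -> x <= y -> y <= q -> 0 <= psi y - psi x <= L * (y - x)) ->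
  ac_families a b F -> ac_families p q (F \o psi).
Proof.
move=> L0 ab lip acF e e0; have [d d0 dF] := acF _ e0.
exists (d / L); first exact: divr_gt0.
move=> I A x y xy dis sd.
apply: (dF I A (psi \o x) (psi \o y)).
- move=> i /xy[h1 h2 h3] /=.
  have /andP[h4 _] := ab _ h1 (le_trans h2 h3).
  have /andP[_ h5] := ab _ (le_trans h1 h2) h3.
  by have /andP[h6 _] := lip _ _ h1 h2 h3; split => //; rewrite -subr_ge0.
- move=> i j Ai Aj ij /=.
  have [h1 h2 h3] := xy i Ai; have [h4 h5 h6] := xy j Aj.
  have [h|h] := dis i j Ai Aj ij; [left|right].
    by have /andP[] := lip _ _ (le_trans h1 h2) h (le_trans h5 h6); rewrite subr_ge0.
  by have /andP[] := lip _ _ (le_trans h4 h5) h (le_trans h2 h3); rewrite subr_ge0.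
- move: sd; rewrite ltr_pdivlMr// => /(le_lt_trans _); apply.
  rewrite mulr_suml; apply: ler_sum => i /xy[h1 h2 h3] /=.
  by have /andP[_] := lip _ _ h1 h2 h3; rewrite mulrC.
Qed.

Lemma ac_familiesS a b p q F : a <= p -> q <= b ->
  ac_families a b F -> ac_families p q F.
Proof.
move=> ap qb acF e /acF[d d0 dF]; exists d => // I A x y xy; apply: dF.
by move=> i /xy[h1 h2 h3]; split => //; [exact: le_trans h1|exact: le_trans qb].
Qed.

End absolute_continuity.

(** * Bounded variation and monotone decomposition *)

Section variation_of_absolutely_continuous.
Context {R : realType}.
Implicit Types (a b p q : R) (F G : R -> R).

(** The cells of all the partitions form one family of nonoverlapping intervals, of the same total
    length. It is indexed by pairs of an interval and a cell, hence the free choice of the index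
    type in [ac_families]. *)
Lemma ac_families_variation a b F : ac_families a b F ->
  forall e : R, 0 < e -> exists2 d : R, 0 < d &
    forall (I : finType) (x y : I -> R) (s : I -> seq R),
      (forall i, [/\ a <= x i, x i <= y i & y i <= b]) ->
      (forall i j, i != j -> y i <= x j \/ y j <= x i) ->
      (forall i, itv_partition (x i) (y i) (s i)) ->
      \sum_i (y i - x i) < d ->
      \sum_i variation (x i) (y i) F (s i) < e.
Proof.
move=> acF e /acF[d d0 dF]; exists d => // I x y s xy dis ps sd.
pose N i k := nth (y i) (x i :: s i) k.
have Nmono i k l : (k <= l)%N -> (l < (size (s i)).+1)%N -> N i k <= N i l.
  move=> kl ls; have [sp _] := ps i.
  apply: (@sorted_leq_nth _ (fun u v : R => u <= v) le_trans lexx (y i) (x i :: s i)) => //.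
    by apply: sub_path sp => u v /ltW.
  by rewrite inE/= (leq_ltn_trans kl).
have Nx i k : (k < (size (s i)).+1)%N -> x i <= N i k.
  by move=> ks; exact: itv_partition_nth_ge.
have Ny i k : (k < (size (s i)).+1)%N -> N i k <= y i.
  by move=> ks; exact: itv_partition_nth_le.
pose J := {i : I & 'I_(size (s i))}.
have sumJ (h : I -> nat -> R) :
    \sum_i \sum_(0 <= k < size (s i)) h i k = \sum_(u : J) h (tag u) (tagged u).
  transitivity (\sum_i \sum_(k < size (s i)) h i k).
    by apply: eq_bigr => i _; rewrite big_mkord.
  by rewrite (sig_big_dep _ (fun _ _ => true)).
rewrite /variation (sumJ (fun i k => `|(F \o nth (y i) (x i :: s i)) k.+1 -
   (F \o nth (y i) (x i :: s i)) k|)).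
apply: (dF J predT (fun u => N (tag u) (tagged u)) (fun u => N (tag u) (tagged u).+1)).
- move=> [i k] _ /=; have [h1 h2 h3] := xy i; have ks := ltn_ord k.
  split; [|exact: Nmono|].
  + by apply: (le_trans h1); apply: Nx; exact: ltnW.
  + by apply: (le_trans _ h3); apply: Ny.
- move=> [i k] [j l] _ _ /=; have [eij|nij _] := eqVneq i j; last first.
    have ks := ltn_ord k; have ls := ltn_ord l.
    have [h|h] := dis i j nij; [left|right].
      by apply: (le_trans (Ny i k.+1 _)) => //; apply: (le_trans h); apply: Nx; exact: ltnW.
    by apply: (le_trans (Ny j l.+1 _)) => //; apply: (le_trans h); apply: Nx; exact: ltnW.
  subst j; have [kl|lk|/val_inj ->] := ltngtP k l; last by rewrite eqxx.
    by left; apply: Nmono => //; exact: (leq_trans (ltn_ord l)).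
  by right; apply: Nmono => //; exact: (leq_trans (ltn_ord k)).
- rewrite -(sumJ (fun i k => N i k.+1 - N i k)).
  apply: le_lt_trans sd; apply: ler_sum => i _; rewrite telescope_sumr//.
  by rewrite /N (itv_partition_nth_size _ (ps i)).
Qed.

Notation TV := total_variation.

(** With [e = 1], an interval shorter than [d] has variation at most [1], and finitely many steps of
    length [d / 2] exhaust [[a, b]]. *)
Lemma ac_families_bounded_variation a b F : a <= b ->
  ac_families a b F -> TV a b F \is a fin_num.
Proof.
move=> ab acF; have [d d0 dF] := ac_families_variation acF ltr01.
have small x y : a <= x -> x <= y -> y <= b -> y - x < d -> (TV x y F <= 1%:E)%E.
  move=> ax xy yb yxd; apply: ge_ereal_sup => _ [r [s ps <-] <-]; rewrite lee_fin.
  have := dF unit (fun=> x) (fun=> y) (fun=> s).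
  rewrite !big_const !card_unit /= !addr0 => /(_ _ _ _ yxd)/ltW; apply => //.
have step n : forall x, a <= x -> x <= b -> x - a <= n%:R * (d / 2) -> TV a x F \is a fin_num.
  elim: n => [x ax xb|n IH x ax xb].
    rewrite mul0r subr_le0 => xa; have -> : x = a by apply/eqP; rewrite eq_le xa.
    by rewrite total_variationxx.
  move=> xn; pose z := Num.max a (x - d / 2).
  have az : a <= z by rewrite le_max lexx.
  have zx : z <= x by rewrite ge_max ax; lra.
  rewrite (total_variationD F az zx) fin_numD; apply/andP; split.
    apply: IH => //; first exact: le_trans xb.
    by rewrite lerBlDr ge_max; apply/andP; split; [|move: xn; rewrite -natr1; lra];
      rewrite lerDr mulr_ge0// ltW// divr_gt0.
  rewrite ge0_fin_numE ?total_variation_ge0//.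
  apply: (@le_lt_trans _ _ 1%:E); last exact: ltry.
  apply: small => //; apply: (@le_lt_trans _ _ (d / 2)); last by lra.
  by rewrite lerBlDr -lerBlDl le_max lexx orbT.
have d2 : 0 < d / 2 by rewrite divr_gt0.
apply: (step (Num.bound ((b - a) / (d / 2)))) => //.
by rewrite -ler_pdivrMr//; apply/ltW/archi_boundP; rewrite divr_ge0 ?subr_ge0// ltW.
Qed.

(** Increments of the total variation function are total variations over the intervals of the
    family. Each is reached up to [eta] by a partition, and the variations along these partitions
    are small by [ac_families_variation]. *)
Lemma ac_families_total_variation a b F : a <= b ->
  ac_families a b F -> ac_families a b (fun x => fine (TV a x F)).
Proof.
move=> ab acF; apply/abs_continuousP => e e0; move: e e0.
have fin x y : a <= x -> x <= y -> y <= b -> TV x y F \is a fin_num.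
  by move=> ax xy yb; apply: ac_families_bounded_variation => //; exact: ac_familiesS acF.
suff : forall e : R, 0 < e -> exists2 d : R, 0 < d &
    forall (I : finType) (x y : I -> R),
      (forall i, [/\ a <= x i, x i <= y i & y i <= b]) ->
      (forall i j, i != j -> y i <= x j \/ y j <= x i) ->
      \sum_i (y i - x i) < d ->
      \sum_i fine (TV (x i) (y i) F) < e.
  move=> H e /H[d d0 dF]; exists d => // n x y xy tI sd.
  have xy' i : [/\ a <= x i, x i <= y i & y i <= b].
    by have [? [/ltW ? ?]] := xy i.
  have -> : \sum_(i < n) `|fine (TV a (y i) F) - fine (TV a (x i) F)| =
            \sum_(i < n) fine (TV (x i) (y i) F).
    apply: eq_bigr => i _; have [h1 h2 h3] := xy' i.
    have f1 : TV a (x i) F \is a fin_num by apply: fin => //; exact: le_trans h3.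
    have f2 := fin _ _ h1 h2 h3.
    rewrite (total_variationD F h1 h2) (fineD f1 f2) addrAC subrr add0r.
    by rewrite ger0_norm// fine_ge0// total_variation_ge0.
  apply: dF => // i j ij.
  have [xi [xyi yi]] := xy i; have [xj [xyj yj]] := xy j.
  by apply: disjoint_itvoo_le => //; move/trivIsetP : tI; apply.
move=> e e0; have e2 : 0 < e / 2 by rewrite divr_gt0.
have [d d0 dF] := ac_families_variation acF e2.
exists d => // I x y xy dis sd.
(* The error [e / 2] is shared equally; the successor keeps [eta] positive for an empty family. *)
pose eta := (e / 2) / (#|I|.+1)%:R.
have eta0 : 0 < eta by rewrite divr_gt0.
have /choice[s ps] : forall i, exists s, itv_partition (x i) (y i) s /\
    fine (TV (x i) (y i) F) <= variation (x i) (y i) F s + eta.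
  move=> i; have [h1 h2 h3] := xy i.
  have [_ [r [s ps <-] <-]] := ub_ereal_sup_adherent eta0 (fin _ _ h1 h2 h3).
  rewrite -/(TV _ _ _) -(fineK (fin _ _ h1 h2 h3)) -EFinB lte_fin => /ltW.
  by rewrite lerBlDr => h; exists s.
apply: (@le_lt_trans _ _ (\sum_i (variation (x i) (y i) F (s i) + eta))).
  by apply: ler_sum => i _; have [] := ps i.
rewrite big_split/=.
have h : \sum_i variation (x i) (y i) F (s i) < e / 2.
  by apply: dF => // i; have [] := ps i.
have : \sum_(i : I) eta <= e / 2.
  rewrite sumr_const -[leLHS]mulr_natr /eta mulrAC ler_pdivrMr//.
  by apply: ler_wpM2l; rewrite ?ler_nat// ltW.
by lra.
Qed.

(* A function of bounded variation is the difference of its total variation and of a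
   nondecreasing function. *)
Lemma ac_families_nondecreasing_decomposition a b F : a <= b -> ac_families a b F ->
  exists G H : R -> R,
    [/\ ac_families a b G, ac_families a b H,
        (forall x y, a <= x -> x <= y -> y <= b -> G x <= G y),
        (forall x y, a <= x -> x <= y -> y <= b -> H x <= H y) &
        F = G \- H].
Proof.
move=> ab acF; pose V x := fine (TV a x F).
have acV := ac_families_total_variation ab acF.
have fin x y : a <= x -> x <= y -> y <= b -> TV x y F \is a fin_num.
  by move=> ax xy yb; apply: ac_families_bounded_variation => //; exact: ac_familiesS acF.
have VF x y : a <= x -> x <= y -> y <= b -> `|F y - F x| <= V y - V x.
  move=> ax xy yb.
  have f1 : TV a x F \is a fin_num by apply: fin => //; exact: le_trans yb.
  have f2 := fin _ _ ax xy yb.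
  rewrite /V (total_variationD F ax xy) (fineD f1 f2) addrAC subrr add0r.
  by rewrite -lee_fin (fineK f2) total_variation_ge.
exists V, (V \- F); split => //.
- by apply: (ac_familiesD acV); have := ac_familiesZ (-1) acF; under eq_fun do rewrite mulN1r.
- by move=> x y ax xy yb; rewrite -subr_ge0; exact: le_trans (VF _ _ ax xy yb).
- move=> x y ax xy yb; have := VF _ _ ax xy yb.
  by rewrite -subr_ge0 /= => h; have := ler_norm (F y - F x); lra.
- by apply/funext => x /=; rewrite opprB addrC subrK.
Qed.

End variation_of_absolutely_continuous.

(** * Radon-Nikodym density of an absolutely continuous distribution function *)

Section density.
Context {R : realType}.
Notation mu := (@lebesgue_measure R).

(** Unbounded shapes are excluded by their infinite measure. The outer interval is half-open because
    a Lebesgue-Stieltjes measure is computed on such intervals, see [P_itvoc]. *)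
Lemma open_interval_of_finite_measure (I : set R) :
  open I -> is_interval I -> I !=set0 -> (mu I < +oo)%E ->
  exists l r : R, [/\ l < r, I `<=` `]l, r]%classic, `]l, r[%classic `<=` I &
                      (mu I = (r - l)%:E)%E].
Proof.
move=> oI /is_intervalP IE [z Iz] fI.
have bI x : I x -> exists2 e : R, 0 < e & I (x - e) /\ I (x + e).
  move=> Ix; have /nbhs_ballP[e /= e0 xeI] := open_nbhs_nbhs (conj oI Ix).
  have e2 : e / 2 < e by rewrite ltr_pdivrMr// ltr_pMr// ltr1n.
  exists (e / 2); first by rewrite divr_gt0.
  by split; apply: xeI; rewrite /ball/= ?opprD ?opprK ?addNKr ?addrA ?subrr ?add0r
    ?normrN gtr0_norm// divr_gt0.
have [e e0 [I1 I2]] := bI _ Iz.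
move: I1 I2 fI bI; rewrite IE lebesgue_measure_itv.
move: (Rhull I) => [[b1 l|[|]] [b2 r|[|]]]; rewrite /= !in_itv//=; last 3 first.
- by rewrite andbF.
- by move=> _ _; rewrite ltry addye// ltxx.
- by move=> _ _; rewrite ltNyr addey// ltxx.
move=> /andP[lz _] /andP[_ zr].
have {lz} lz : l <= z - e by case: b1 lz => // /ltW.
have {zr} zr : z + e <= r by case: b2 zr => // /ltW.
have lr : l < r by lra.
rewrite lte_fin lr -EFinB => _ bI; exists l, r; split => //.
  move=> x Ix; have [d d0 []] := bI _ Ix; move: Ix; rewrite /= !in_itv/= => /andP[_ xr] /andP[ld _] _.
  apply/andP; split; last by case: b2 xr {bI} => // /ltW.
  have {ld} : l <= x - d by case: b1 ld {bI} => // /ltW.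
  lra.
by move=> x; rewrite /= !in_itv/= => /andP[lx xr]; rewrite !lteifS.
Qed.

Variables (C : R -> R).
Hypothesis ndC : {homo C : x y / x <= y}.
Hypothesis cC : continuous C.
Hypothesis CNy : C @ -oo --> (0 : R).
Hypothesis Cy : C @ +oo --> (1 : R).
Hypothesis acC : forall e : R, 0 < e -> exists2 d : R, 0 < d &
    forall (I : finType) (A : pred I) (x y : I -> R),
      (forall i, A i -> x i <= y i) ->
      (forall i j, A i -> A j -> i != j -> y i <= x j \/ y j <= x i) ->
      \sum_(i | A i) (y i - x i) < d ->
      \sum_(i | A i) (C (y i) - C (x i)) < e.

Let CB := C.

#[local] HB.instance Definition _ :=
  isCumulative.Build R _ R CB ndC (right_continuousW cC).
#[local] HB.instance Definition _ := isCumulativeBounded.Build R 0 1 CB CNy Cy.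

Let P := lebesgue_stieltjes_measure (CB : cumulativeBounded (0 : R) (1 : R)).

Let P_itvoc (x y : R) : x <= y -> P `]x, y]%classic = (C y - C x)%:E.
Proof.
move=> xy; rewrite /P/= /lebesgue_stieltjes_measure.
by rewrite /measure_extension measurable_mu_extE/=; [rewrite wlength_itv_bnd|exact: is_ocitv].
Qed.

(** A null set lies in an open set [U] of measure below [d]. The components of [U] are disjoint
    intervals, and any finitely many of them form a family of total length below [d], hence of small
    [P]-measure by [acC]. Countable additivity passes to [U]. *)
Let P_dominated : P `<< mu.
Proof.
apply/null_content_dominatesP => A mA A0.
apply/eqP; rewrite eq_le measure_ge0 andbT; apply/lee_addgt0Pr => e e0; rewrite add0e.
have [d d0 dC] := acC e0.
have [|U [oU AU UAd]] := lebesgue_regularity_outer mA _ d0.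
  by rewrite A0.
have mU : measurable U by exact: open_measurable.
have Ud : (mu U < d%:E)%E.
  rewrite -(setDUK AU) measureU ?A0 ?add0e//; [exact: measurableD|].
  by rewrite setDIK.
apply: (@le_trans _ _ (P U)); first by apply: le_measure; rewrite ?inE.
pose J := open_disjoint_itv oU.
have oJ i : open (J i) by exact: open_disjoint_itv_open.
have mJ i : measurable (J i) by exact: open_measurable.
have tJ : trivIset setT J by exact: open_disjoint_itv_trivIset.
have UE : U = \bigcup_i J i by exact: open_disjoint_itv_bigcup.
have muJ i : (mu (J i) < +oo)%E.
  apply: (@le_lt_trans _ _ (mu U)); last by rewrite (lt_trans Ud) ?ltry.
  by apply: le_measure; rewrite ?inE; [exact: mJ|exact: mU|rewrite UE; exact: bigcup_sup].
have /choice[x /choice[y xyJ]] : forall i, exists x y : R, J i !=set0 ->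
    [/\ x < y, J i `<=` `]x, y]%classic, `]x, y[%classic `<=` J i &
                      (mu (J i) = (y - x)%:E)%E].
  move=> i; have [J0|/set0P/negP/negPn/eqP J0] := pselect (J i !=set0).
    have [l [r H]] := open_interval_of_finite_measure (oJ i)
      (@open_disjoint_itv_is_interval _ _ oU i) J0 (muJ i).
    by exists l, r.
  by exists 0, 0 => /set0P; rewrite J0 eqxx.
have mbJ : measurable (\bigcup_i J i) by exact: bigcup_measurable.
have -> : P U = (\sum_(i <oo) P (J i))%E.
  by rewrite {1}UE; apply: measure_semi_bigcup; [exact: mJ|exact: tJ|exact: mbJ].
apply: lime_le; first by apply: is_cvg_nneseries.
apply: nearW => n; rewrite big_mkord.
(* Empty components carry no meaningful endpoints and are dropped. *)
pose A' := [pred i : 'I_n | J i != set0].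
rewrite (bigID A')/= [X in (_ + X)%E]big1 ?adde0; last first.
  by move=> i /negPn/eqP ->; exact: measure0.
apply: (@le_trans _ _ (\sum_(i < n | A' i) (C (y i) - C (x i))%:E)%E).
  apply: lee_sum => i /set0P/xyJ[xy Jxy _ _].
  rewrite -P_itvoc ?(ltW xy)//; apply: le_measure; rewrite ?inE; [exact: mJ| |exact: Jxy].
  exact: (@measurable_itv R `]x i, y i]).
rewrite sumEFin lee_fin; apply/ltW/(dC 'I_n A').
- by move=> i /set0P/xyJ[/ltW].
- move=> i j /set0P/xyJ[xyi _ Ji _] /set0P/xyJ[xyj _ Jj _] ij.
  apply: disjoint_itvoo_le => //; apply/seteqP; split => // z [/Ji zi /Jj zj].
  by move/trivIsetP : tJ => /(_ i j Logic.I Logic.I ij) <-.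
rewrite -lte_fin; apply: le_lt_trans Ud; rewrite -sumEFin.
rewrite (eq_bigr (fun i : 'I_n => mu (J i))); last first.
  by move=> i /set0P/xyJ[].
apply: (@le_trans _ _ (\sum_(i < n) mu (J i))%E).
  by rewrite [leRHS](bigID A')/= leeDl// sume_ge0.
rewrite -(big_mkord predT (fun i => mu (J i))) (_ : mu U = \sum_(i <oo) mu (J i))%E.
  exact: nneseries_lim_ge.
by rewrite {1}UE; apply: measure_semi_bigcup; [exact: mJ|exact: tJ|exact: mbJ].
Qed.

Lemma cumulative_density : exists g : R -> R,
  mu.-integrable setT (EFin \o g) /\
  forall x y : R, x <= y -> C y - C x = \int[mu]_(t in `]x, y]) g t.
Proof.
have [g [g0 gfin intg Pg]] := radon_nikodym_sigma_finite P_dominated.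
(* The density given by Radon-Nikodym is finite everywhere, so [fine] loses nothing. *)
exists (fine \o g); have -> : EFin \o (fine \o g) = g.
  by apply/funext => x /=; rewrite fineK.
split => // x y xy; rewrite /Rintegral.
under eq_integral do rewrite /= fineK//.
transitivity (fine (P `]x, y]%classic)); first by rewrite P_itvoc.
by congr fine; apply: Pg; exact: (@measurable_itv R `]x, y]).
Qed.

End density.

(** * Densities on a segment and almost everywhere differentiability *)

Section density_on_segment.
Context {R : realType}.
Notation mu := (@lebesgue_measure R).
Implicit Types (a b : R) (F H : R -> R).

Lemma ac_families_within_continuous a b F : ac_families a b F ->
  forall e : R, 0 < e -> exists2 d : R, 0 < d &
    forall x y, a <= x -> x <= y -> y <= b -> y - x < d -> `|F y - F x| < e.
Proof.
move=> acF e /acF[d d0 dF]; exists d => // x y ax xy yb yxd.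
have := dF unit predT (fun=> x) (fun=> y).
by rewrite !big_const !card_unit /= !addr0; apply => // -[] [].
Qed.

(** [H] is turned into a distribution function, normalized to increase by [1] on [[a, b]] and
    constant outside. Radon-Nikodym applies to it, and the normalization is then undone on the
    density. *)
Lemma nondecreasing_ac_density a b H : a < b -> ac_families a b H ->
  (forall x y, a <= x -> x <= y -> y <= b -> H x <= H y) ->
  exists g : R -> R, mu.-integrable `[a, b] (EFin \o g) /\
    forall x, a <= x -> x <= b -> H x - H a = \int[mu]_(t in `]a, x]) g t.
Proof.
move=> ab acH ndH; have aa := lexx a; have bb := lexx b; have ab' := ltW ab.
(* Adding the identity to [H] makes the total increase [D] positive even if [H] is constant; it
   accounts for the [- 1] in the final density. *)
pose D := H b - H a + (b - a).
have D0 : 0 < D by rewrite ltr_wpDl ?subr_ge0 ?ndH// subr_gt0.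
pose F x := D^-1 * (H x + x - (H a + a)).
have acF : ac_families a b F.
  apply: ac_familiesZ; apply: ac_familiesD; last first.
    by apply: (@ac_families_lipschitz _ _ _ _ 0) => x y _ _ _; rewrite subrr normr0 mul0r.
  apply: (ac_familiesD acH).
  by apply: (@ac_families_lipschitz _ _ _ _ 1) => x y _ xy _; rewrite mul1r ger0_norm// subr_ge0.
(* Clamping to [[a, b]] makes [C] constant on either side, with values [0] and [1]. *)
pose cl x := Num.max a (Num.min x b).
have acl x : a <= cl x by rewrite le_max lexx.
have clb x : cl x <= b by rewrite ge_max ab' ge_min lexx orbT.
have cl_id x : a <= x -> x <= b -> cl x = x.
  by move=> ax xb; rewrite /cl (min_idPl xb) (max_idPr ax).
have cl_le x y : x <= y -> cl x <= cl y.
  move=> xy; rewrite /cl ge_max le_max lexx/= le_max; apply/orP; right.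
  by rewrite le_min ge_min xy/= ge_min lexx orbT.
have cl_lip x y : x <= y -> cl y - cl x <= y - x.
  move=> xy; rewrite /cl.
  have [] := leP x b; have [] := leP y b; move=> h1 h2;
    repeat (match goal with |- context[Num.max ?u ?v] => have [] := leP u v; move=> ? end); lra.
pose C := F \o cl.
have ndF x y : a <= x -> x <= y -> y <= b -> F x <= F y.
  move=> ax xy yb; rewrite ler_pM2l ?invr_gt0// lerD2r lerD//; exact: ndH.
have ndC : {homo C : x y / x <= y} by move=> x y xy; apply: ndF; rewrite ?acl ?clb ?cl_le.
have acC e : 0 < e -> exists2 d : R, 0 < d &
    forall (I : finType) (A : pred I) (x y : I -> R),
      (forall i, A i -> x i <= y i) ->
      (forall i j, A i -> A j -> i != j -> y i <= x j \/ y j <= x i) ->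
      \sum_(i | A i) (y i - x i) < d ->
      \sum_(i | A i) (C (y i) - C (x i)) < e.
  move=> /acF[d d0 dF]; exists d => // I A x y xy dis sd.
  apply: (@le_lt_trans _ _ (\sum_(i | A i) `|F (cl (y i)) - F (cl (x i))|)).
    by apply: ler_sum => i _; rewrite ler_norm.
  apply: (dF I A (cl \o x) (cl \o y)) => //.
  - by move=> i /xy h; split; [exact: acl|exact: cl_le|exact: clb].
  - by move=> i j Ai Aj /(dis _ _ Ai Aj)[h|h]; [left|right]; exact: cl_le.
  - by apply: le_lt_trans sd; apply: ler_sum => i /xy; exact: cl_lip.
have cC : continuous C.
  move=> x; apply/cvgrPdist_lt => e e0; have [d d0 dC] := acC e e0.
  have close u v : u <= v -> v - u < d -> C v - C u < e.
    move=> uv vud; have := dC unit predT (fun=> u) (fun=> v).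
    by rewrite !big_const !card_unit /= !addr0; apply => // -[] [].
  exists d => //= y; rewrite /ball_/= => xyd.
  have [xy|/ltW yx] := leP x y.
    rewrite distrC ger0_norm ?subr_ge0 ?ndC//; apply: close => //.
    by rewrite -[y - x]ger0_norm ?subr_ge0// distrC.
  rewrite ger0_norm ?subr_ge0 ?ndC//; apply: close => //.
  by rewrite -[x - y]ger0_norm ?subr_ge0.
have CNy : C @ -oo --> (0 : R).
  apply: cvg_near_cst; near=> x.
  have xa : x <= a by near: x; apply: nbhs_ninfty_le; exact: num_real.
  by rewrite /C /F /= /cl (min_idPl (le_trans xa ab')) (max_idPl xa) subrr mulr0.
have Cy : C @ +oo --> (1 : R).
  apply: cvg_near_cst; near=> x.
  have xb : b <= x by near: x; apply: nbhs_pinfty_ge; exact: num_real.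
  rewrite /C /F /= /cl (min_idPr xb) (max_idPr ab') opprD addrACA.
  by rewrite -/D mulVf// gt_eqF.
have [g [intg Cg]] := cumulative_density ndC cC CNy Cy acC.
have intgS A : measurable A -> mu.-integrable A (EFin \o g).
  by move=> mA; exact: (integrableS measurableT mA _ intg).
have int1 : mu.-integrable `[a, b] (EFin \o (fun=> 1 : R)).
  by apply: continuous_compact_integrable; [exact: segment_compact|exact: cst_continuous].
have mab (x : R) : measurable `]a, x]%classic by exact: measurable_itv.
have subab x : x <= b -> `]a, x]%classic `<=` `[a, b]%classic.
  by move=> xb; apply: subset_itvScc; rewrite bnd_simp.
have intDg A : measurable A -> mu.-integrable A (EFin \o (fun x => D * g x)).
  by move=> mA; apply: integrable_EFinZ => //; exact: intgS.
exists (fun x => D * g x - 1); split.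
  by apply: integrable_EFinB => //; apply: intDg; exact: measurable_itv.
move=> x ax xb; rewrite RintegralB//; [|exact: intDg|exact: (integrable_itvS (subab _ xb))].
rewrite RintegralZl//; last exact: intgS.
rewrite -Cg// Rintegral_cst_itv//.
rewrite mul1r /C /F /= !cl_id//= -mulrBr mulrA divff ?gt_eqF//.
lra.
Unshelve. all: by end_near. Qed.

(** The densities of the two monotone parts are subtracted, and Lebesgue's differentiation theorem
    recovers the derivative from the integral. *)
Theorem ac_families_density a b F : a < b -> ac_families a b F ->
  exists g : R -> R, [/\ mu.-integrable `[a, b] (EFin \o g),
    (forall x, a <= x -> x <= b -> F x - F a = \int[mu]_(t in `[a, x]) g t) &
    {ae mu, forall x, x \in `]a, b[ -> is_derive x 1 F (g x)}].
Proof.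
move=> ab acF; have ab' := ltW ab.
have [G [H [acG acH ndG ndH FE]]] := ac_families_nondecreasing_decomposition ab' acF.
have [g [intg Gg]] := nondecreasing_ac_density ab acG ndG.
have [h [inth Hh]] := nondecreasing_ac_density ab acH ndH.
have subab x : x <= b -> `]a, x]%classic `<=` `[a, b]%classic.
  by move=> xb; apply: subset_itvScc; rewrite bnd_simp.
have subab' x : x <= b -> `[a, x]%classic `<=` `[a, b]%classic.
  by move=> xb; apply: subset_itvScc; rewrite bnd_simp.
have intgh : mu.-integrable `[a, b] (EFin \o (g \- h)).
  exact: integrable_EFinB.
have Fgh x : a <= x -> x <= b -> F x - F a = \int[mu]_(t in `[a, x]) (g \- h) t.
  move=> ax xb; rewrite -Rintegral_itv_obnd_cbnd; last exact: (integrable_itvS (subab _ xb)).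
  rewrite RintegralB//; [|exact: (integrable_itvS (subab _ xb))..].
  rewrite -Gg// -Hh// FE /=; lra.
exists (g \- h); split => //.
(* [FTC1] asks for local integrability on the whole line, so the density is cut off outside
   [[a, b]]. *)
pose k := (g \- h) \_ `[a, b].
have intk : mu.-integrable setT (EFin \o k).
  by apply: integrable_EFin_restrict.
have lock : locally_integrable setT k by exact: integrable_locally_restrict.
have kA A : measurable A -> mu.-integrable A (EFin \o k).
  by move=> mA; exact: integrableS intk.
have := @FTC1 R k (BLeft a) (fun y => kA _ (measurable_itv _)) lock.
apply: filterS; first exact: (ae_filter_ringOfSetsType mu).
move=> x /= + /[!in_itv]/= /andP[ax xb].
rewrite lte_fin => /(_ ax) [dF0 F0k].
pose F0 y := \int[mu]_(t in `[a, y]) k t.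
have F0E : {near x, (fun y => F0 y + F a) =1 F}.
  near=> y.
  have ay : a <= y by apply/ltW; near: y; exact: lt_nbhsr.
  have yb : y <= b by apply/ltW; near: y; exact: lt_nbhsl.
  rewrite -[RHS](subrK (F a)) Fgh//; congr (_ + _).
  apply: eq_Rintegral => t; rewrite inE/= => tay; rewrite /k patchE mem_set//.
  exact: subab' tay.
have -> : g x - h x = k x by rewrite /k patchE mem_set//= in_itv/= !ltW.
apply: near_eq_is_derive F0E _.
have dF : is_derive x 1 F0 (k x).
  by apply: DeriveDef => //; rewrite -derive1E.
by have := is_deriveD dF (is_derive_cst (F a) x 1); rewrite addr0.
Unshelve. all: by end_near. Qed.

End density_on_segment.

(** * Square integrable functions *)

Section square_integrable.
Context {R : realType}.
Notation mu := (@lebesgue_measure R).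
Variables (A : set R) (mA : measurable A).
Implicit Types f g : R -> R.

Lemma sq_integrableP f : sq_integrable A f <->
  measurable_fun A f /\ mu.-integrable A (EFin \o (fun x => f x ^+ 2)).
Proof.
have E : (\int[mu]_(x in A) (`|f x| ^+ 2)%:E = \int[mu]_(x in A) `|(f x ^+ 2)%:E|)%E.
  by apply: eq_integral => x _; rewrite abse_EFin normrX.
rewrite /sq_integrable E; split=> -[mf h]; split => //.
  by apply/integrableP; split => //; apply/measurable_EFinP; exact: measurable_funX.
by have /integrableP[] := h.
Qed.

Lemma le_integrable_EFin f g : measurable_fun A f -> (forall x, A x -> `|f x| <= `|g x|) ->
  mu.-integrable A (EFin \o g) -> mu.-integrable A (EFin \o f).
Proof.
by move=> mf fg; apply: le_integrable => //; exact/measurable_EFinP.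
Qed.

Lemma measurable_integrable f : mu.-integrable A (EFin \o f) -> measurable_fun A f.
Proof. by move=> /integrableP[/measurable_EFinP]. Qed.

Lemma sq_integrable_le f g : measurable_fun A f -> (forall x, A x -> f x ^+ 2 <= g x) ->
  mu.-integrable A (EFin \o g) -> sq_integrable A f.
Proof.
move=> mf fg intg; apply/sq_integrableP; split => //.
apply: le_integrable_EFin _ _ intg; first exact: measurable_funX.
by move=> x Ax; rewrite ger0_norm ?sqr_ge0// (le_trans (fg _ Ax))// ler_norm.
Qed.

(** The dominating function comes from [|f g| <= f^2 + g^2]. *)
Lemma sq_integrableM f g : sq_integrable A f -> sq_integrable A g ->
  mu.-integrable A (EFin \o (fun x => f x * g x)).
Proof.
move=> /sq_integrableP[mf f2] /sq_integrableP[mg g2].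
apply: le_integrable_EFin; [exact: measurable_funM| |exact: integrable_EFinD f2 g2].
move=> x _; rewrite [leRHS]ger0_norm ?addr_ge0 ?sqr_ge0//.
by rewrite ler_norml; apply/andP; split; nra.
Qed.

Lemma sq_integrableB f g : sq_integrable A f -> sq_integrable A g ->
  sq_integrable A (fun x => f x - g x).
Proof.
move=> /sq_integrableP[mf f2] /sq_integrableP[mg g2].
apply: sq_integrable_le (integrable_EFinZ mA 2 (integrable_EFinD mA f2 g2)).
  exact: measurable_funB.
move=> x _ /=; have := sqr_ge0 (f x + g x); lra.
Qed.

Lemma sq_integrableD f g : sq_integrable A f -> sq_integrable A g ->
  sq_integrable A (fun x => f x + g x).
Proof.
move=> /sq_integrableP[mf f2] /sq_integrableP[mg g2].
apply: sq_integrable_le (integrable_EFinZ mA 2 (integrable_EFinD mA f2 g2)).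
  exact: measurable_funD.
move=> x _ /=; have := sqr_ge0 (f x - g x); lra.
Qed.

Lemma eq_sq_integrable f g : {in A, f =1 g} -> sq_integrable A f -> sq_integrable A g.
Proof.
move=> fg [mf h]; split; first exact: eq_measurable_fun mf.
suff <- : (\int[mu]_(x in A) (`|f x| ^+ 2)%:E = \int[mu]_(x in A) (`|g x| ^+ 2)%:E)%E by [].
by apply: eq_integral => x xA; rewrite fg.
Qed.

Lemma cst_integrable (c : R) : (mu A < +oo)%E -> mu.-integrable A (EFin \o (fun=> c)).
Proof.
move=> fA; apply/integrableP; split; first exact/measurable_EFinP/measurable_cst.
have -> : (\int[mu]_(x in A) `|(EFin \o (fun=> c)) x| = `|c|%:E * mu A)%E.
  exact: integral_cst.
exact: lte_mul_pinfty.
Qed.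

(** [f] is its own product with the constant [1], which is square integrable on a set of finite
    measure. *)
Lemma sq_integrable_integrable f : (mu A < +oo)%E -> sq_integrable A f ->
  mu.-integrable A (EFin \o f).
Proof.
move=> fA sf; have := sq_integrableM sf (g := fun=> 1).
under [X in mu.-integrable _ (_ \o X)]eq_fun do rewrite mulr1.
apply; apply: (@sq_integrable_le _ (fun=> 1)); first exact: measurable_cst.
  by move=> x _; rewrite expr1n.
exact: cst_integrable.
Qed.

End square_integrable.

Section square_integrable_subset.
Context {R : realType}.
Notation mu := (@lebesgue_measure R).

Lemma sq_integrableS (A B : set R) (f : R -> R) : measurable A -> measurable B ->
  B `<=` A -> sq_integrable A f -> sq_integrable B f.
Proof.
move=> mA mB BA /sq_integrableP[mf f2]; apply/sq_integrableP; split.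
  exact: measurable_funS mf.
exact: integrableS f2.
Qed.

Lemma sq_integrableU (A B : set R) (f : R -> R) : measurable A -> measurable B ->
  sq_integrable A f -> sq_integrable B f -> sq_integrable (A `|` B) f.
Proof.
move=> mA mB /sq_integrableP[mfA fA] /sq_integrableP[mfB fB].
apply/sq_integrableP; split; first by apply/measurable_funU.
(* The sets may overlap, so [B] is replaced by its part outside [A]. *)
pose B' := (A `|` B) `\` A.
have mB' : measurable B' by apply: measurableD => //; exact: measurableU.
have B'B : B' `<=` B by move=> x [[]].
have /integrableP[mfB' fB'] : mu.-integrable B' (EFin \o (fun x => f x ^+ 2)).
  exact: integrableS fB.
have /integrableP[mfA' fA'] := fA.
have mAB' : measurable_fun (A `|` B') (EFin \o (fun x => f x ^+ 2)) by apply/measurable_funU.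
rewrite -(setDUK (@subsetUl _ A B)); apply/integrableP; split => //.
rewrite ge0_integral_setU//; first exact: lte_add_pinfty.
  exact: measurableT_comp.
by apply/disj_setPS => x [? []].
Qed.

(* Cauchy-Schwarz, from the nonnegativity of the integral of [(f - c) ^ 2] for [c] the
   mean of [f] *)
Lemma sqr_Rintegral_le (x y : R) (f : R -> R) : x <= y ->
  sq_integrable `[x, y] f ->
  (\int[mu]_(t in `[x, y]) f t) ^+ 2 <= (y - x) * \int[mu]_(t in `[x, y]) f t ^+ 2.
Proof.
have mI : measurable `[x, y]%classic by exact: measurable_itv.
rewrite le_eqVlt => /predU1P[<-|xy] sf.
  by rewrite set_itv1 /Rintegral !integral_set1 subrr mul0r expr0n.
have muI : mu `[x, y]%classic = (y - x)%:E.
  by apply: lebesgue_measure_itv_bounded; exact: ltW.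
have fI : (mu `[x, y]%classic < +oo)%E by rewrite muI ltry.
have [mf f2] := (sq_integrableP _ f).1 sf.
have f1 : mu.-integrable `[x, y] (EFin \o f) by exact: sq_integrable_integrable.
have xy0 : 0 < y - x by rewrite subr_gt0.
pose J := \int[mu]_(t in `[x, y]) f t; pose c := J / (y - x).
have c1 := cst_integrable mI (c ^+ 2) fI.
have cf := integrable_EFinZ mI (2 * c) f1.
have : 0 <= \int[mu]_(t in `[x, y]) (f t ^+ 2 - 2 * c * f t + c ^+ 2).
  by apply: Rintegral_ge0 => t _; have := sqr_ge0 (f t - c); lra.
rewrite RintegralD//; last exact: integrable_EFinB.
rewrite RintegralB// RintegralZl// Rintegral_cst_itv ?(ltW xy)// -/J.
have Jc : J = c * (y - x) by rewrite /c mulfVK// gt_eqF.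
set S := (X in _ -> _ <= _ * X); rewrite -/S; move: Jc; move: J c {c1 cf} => J c -> h.
have : 0 <= (y - x) * (S - c ^+ 2 * (y - x)) by apply: mulr_ge0; [exact: ltW|lra].
lra.
Qed.

End square_integrable_subset.

(** * Absolute continuity of indefinite integrals *)

Section indefinite_integral.
Context {R : realType}.
Notation mu := (@lebesgue_measure R).

(** The integral of [|g|] over a set of small measure is small; this is applied to the union of the
    intervals of the family. *)
Lemma ac_families_Rintegral (a b : R) (g : R -> R) : mu.-integrable `[a, b] (EFin \o g) ->
  ac_families a b (fun x => \int[mu]_(t in `[a, x]) g t).
Proof.
move=> intg; have mab : measurable `[a, b]%classic by exact: measurable_itv.
pose k := g \_ `[a, b].
have intk : mu.-integrable setT (EFin \o k) by exact: integrable_EFin_restrict.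
move=> e e0; have [d [d0 dk]] := integral_normr_continuous intk e0.
exists d => // I A x y xy dis sd.
(* Half-open intervals stay disjoint when two members of the family touch. *)
pose J i := `]x i, y i]%classic.
have mJ i : measurable (J i) by exact: measurable_itv.
have kA B : measurable B -> mu.-integrable B (EFin \o k).
  by move=> mB; exact: integrableS intk.
have nkA B : measurable B -> mu.-integrable B (EFin \o (fun t => `|k t|)).
  by move=> mB; exact: integrable_norm (kA _ mB).
pose D := \big[setU/set0]_(i <- enum A) J i.
have mD : measurable D by exact: bigsetU_measurable.
have tJ : trivIset [set` enum A] J.
  apply/trivIsetP => i j /=; rewrite !mem_enum => Ai Aj ij.
  apply/seteqP; split => // z [/=]; rewrite /J/= !in_itv/= => /andP[z1 z2] /andP[z3 z4].
  by have [h|h] := dis i j Ai Aj ij; lra.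
have sumD (f : R -> R) : (forall t, 0 <= f t) -> measurable_fun D f ->
    (\int[mu]_(t in D) (f t)%:E = \sum_(i | A i) \int[mu]_(t in J i) (f t)%:E)%E.
  move=> f0 mf; rewrite ge0_integral_bigsetU ?enum_uniq//; first by rewrite big_enum.
  - exact/measurable_EFinP.
  - by move=> t _; rewrite lee_fin.
have muD : (mu D < d%:E)%E.
  have := sumD (fun=> 1) (fun=> ler01) (measurable_cst _).
  rewrite integral_cst// mul1e => ->.
  rewrite (eq_bigr (fun i => (y i - x i)%:E)) ?sumEFin ?lte_fin// => i Ai.
  rewrite integral_cst; last exact: mJ.
  by rewrite mul1e; apply: lebesgue_measure_itv_bounded; have [] := xy i Ai.
apply: le_lt_trans (dk _ mD muD); rewrite /Rintegral sumD//; last first.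
  by apply: measurable_integrable; exact: nkA mD.
rewrite -sum_fine => [|i _]; last first.
  by apply: integrable_fin_num; [exact: mJ|exact: nkA (mJ i)].
apply: ler_sum => i /xy[ax xyi yb].
rewrite Rintegral_itvB//; last first.
  by apply: integrable_itvS intg; apply: subset_itvl; rewrite bnd_simp.
have -> : \int[mu]_(t in `]x i, y i]) g t = \int[mu]_(t in `]x i, y i]) k t.
  apply: eq_Rintegral => t; rewrite inE/= in_itv/= => /andP[xt ty].
  by rewrite /k patchE mem_set//= in_itv/= (le_trans ax (ltW xt)) (le_trans ty yb).
by apply: le_normr_Rintegral; [exact: measurable_itv|apply: kA; exact: measurable_itv].
Qed.

End indefinite_integral.

(** * Stability of F. Riesz's class *)

Section riesz_class.
Context {R : realType}.
Notation mu := (@lebesgue_measure R).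
Implicit Types (a b p q : R) (F G M : R -> R).

(* F. Riesz's form of "[F] is absolutely continuous with a square integrable
   derivative": [M] plays the role of a primitive of [F'^2]. *)
Definition riesz p q F : Prop := exists2 M : R -> R, ac_families p q M &
  forall x y, p <= x -> x <= y -> y <= q -> (F y - F x) ^+ 2 <= (y - x) * (M y - M x).

Lemma norm_le_mean (u v w : R) : 0 <= v -> 0 <= w -> u ^+ 2 <= v * w -> `|u| <= (v + w) / 2.
Proof.
move=> v0 w0 uvw; rewrite -(@ler_pXn2r _ 2)// ?nnegrE ?divr_ge0 ?addr_ge0//.
rewrite real_normK ?num_real//; have := sqr_ge0 (v - w); lra.
Qed.

(** Cauchy-Schwarz for two terms: [2 A B <= u t + v s] because [(A B)^2 <= (u t) (v s)]. It serves
    for an interval that straddles a glueing point. *)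
Lemma sqr_add_le_mul (u v s t A B : R) : 0 <= u -> 0 <= v -> 0 <= s -> 0 <= t ->
  A ^+ 2 <= u * s -> B ^+ 2 <= v * t -> (A + B) ^+ 2 <= (u + v) * (s + t).
Proof.
move=> u0 v0 s0 t0 hA hB.
have AB : 2 * (A * B) <= u * t + v * s.
  have h : (2 * (A * B)) ^+ 2 <= (u * t + v * s) ^+ 2.
    have : A ^+ 2 * B ^+ 2 <= (u * s) * (v * t) by apply: ler_pM; rewrite ?sqr_ge0.
    have := sqr_ge0 (u * t - v * s); lra.
  have p0 : 0 <= u * t + v * s by rewrite addr_ge0 ?mulr_ge0.
  apply: (le_trans (ler_norm _)).
  by rewrite -(@ler_pXn2r _ 2)// ?nnegrE// real_normK ?num_real.
lra.
Qed.

(** Squares are nonnegative, so the inequality forces [M] to increase. *)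
Lemma riesz_le p q F M :
  (forall x y, p <= x -> x <= y -> y <= q -> (F y - F x) ^+ 2 <= (y - x) * (M y - M x)) ->
  forall x y, p <= x -> x <= y -> y <= q -> M x <= M y.
Proof.
move=> FM x y px; rewrite le_eqVlt => /predU1P[->//|xy] yq.
have := le_trans (sqr_ge0 _) (FM x y px (ltW xy) yq).
by rewrite pmulr_rge0 ?subr_gt0// subr_ge0.
Qed.

(** By the arithmetic-geometric mean inequality, an increment of [F] is at most the mean of those of
    the identity and of [M]. *)
Lemma riesz_ac p q F : riesz p q F -> ac_families p q F.
Proof.
move=> [M acM FM] e e0; have [d d0 dM] := acM _ e0.
exists (Num.min d e); first by rewrite lt_min d0.
move=> I A x y xy dis; rewrite lt_min => /andP[sd se].
have h := dM I A x y xy dis sd.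
apply: (@le_lt_trans _ _ (\sum_(i | A i) ((y i - x i) / 2 + `|M (y i) - M (x i)| / 2))).
  apply: ler_sum => i /xy[h1 h2 h3].
  have M0 : 0 <= M (y i) - M (x i) by rewrite subr_ge0; exact: (riesz_le FM).
  rewrite (ger0_norm M0) -mulrDl; apply: norm_le_mean => //; first by rewrite subr_ge0.
  exact: FM.
rewrite big_split/= -!mulr_suml; lra.
Qed.

Lemma riesz_lipschitz p q F (K : R) :
  (forall x y, p <= x -> x <= y -> y <= q -> `|F y - F x| <= K * (y - x)) ->
  riesz p q F.
Proof.
move=> lF; exists (fun x => K ^+ 2 * x) => [|x y px xy yq].
  apply: ac_familiesZ; apply: (@ac_families_lipschitz _ _ _ _ 1) => x y _ xy _.
  by rewrite mul1r ger0_norm// subr_ge0.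
have := lF _ _ px xy yq; rewrite ler_norml => /andP[h1 h2].
have h3 : `|F y - F x| <= K * (y - x) by exact: lF.
rewrite -mulrBr -real_normK ?num_real//.
have -> : (y - x) * (K ^+ 2 * (y - x)) = (K * (y - x)) ^+ 2 by ring.
by rewrite ler_pXn2r// ?nnegrE// (le_trans _ h3).
Qed.

Lemma riesz_cst p q (c : R) : riesz p q (fun=> c).
Proof.
by apply: (@riesz_lipschitz _ _ _ 0) => x y _ _ _; rewrite subrr normr0 mul0r.
Qed.

Lemma rieszS a b p q F : a <= p -> q <= b -> riesz a b F -> riesz p q F.
Proof.
move=> ap qb [M acM FM]; exists M; first exact: ac_familiesS acM.
by move=> x y px xy yq; apply: FM => //; [exact: le_trans px|exact: le_trans qb].
Qed.

Lemma eq_riesz p q F G : (forall x, p <= x -> x <= q -> F x = G x) ->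
  riesz p q F -> riesz p q G.
Proof.
move=> FG [M acM FM]; exists M => // x y px xy yq.
by rewrite -!FG ?(le_trans px)// ?(le_trans xy)//; exact: FM.
Qed.

Lemma riesz_bounded p q F : riesz p q F ->
  exists2 K : R, 0 < K & forall x, p <= x -> x <= q -> `|F x| <= K.
Proof.
(* [u <= 1 + u ^+ 2] replaces a square root in this bound. *)
move=> [M acM FM]; pose K := 1 + `|F p| + (q - p) * (M q - M p).
have [pq|qp] := leP p q; last first.
  by exists 1 => // x px xq; have := le_lt_trans (le_trans px xq) qp; rewrite ltxx.
have Mpq := riesz_le FM (lexx p) pq (lexx q).
have K0 : 0 <= (q - p) * (M q - M p) by rewrite mulr_ge0 ?subr_ge0.
exists K; first by rewrite /K -addrA ltr_pwDl// addr_ge0.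
move=> x px xq.
have h1 : (F x - F p) ^+ 2 <= (q - p) * (M q - M p).
  apply: (le_trans (FM _ _ (lexx p) px xq)); apply: ler_pM.
  - by rewrite subr_ge0.
  - by rewrite subr_ge0; exact: (riesz_le FM).
  - by rewrite lerD2r.
  - by rewrite lerD2r; exact: (riesz_le FM).
have h2 : `|F x - F p| <= 1 + (q - p) * (M q - M p).
  move: h1; rewrite -[X in X <= _]real_normK ?num_real//.
  have := sqr_ge0 (`|F x - F p| - 1); nra.
have h3 : `|F x| <= `|F x - F p| + `|F p| by rewrite -{1}(subrK (F p) (F x)) ler_normD.
rewrite /K; lra.
Qed.

Lemma rieszD p q F G : riesz p q F -> riesz p q G -> riesz p q (fun x => F x + G x).
Proof.
move=> [M acM FM] [N acN GN]; exists (fun x => 2 * (M x + N x)).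
  by apply: ac_familiesZ; exact: ac_familiesD.
move=> x y px xy yq; have := FM _ _ px xy yq; have := GN _ _ px xy yq.
have := sqr_ge0 ((F y - F x) - (G y - G x)); nra.
Qed.

(** The increment of the product is [G y (F y - F x) + F x (G y - G x)], and the factors [G y] and
    [F x] are bounded on the segment. *)
Lemma rieszM p q F G : riesz p q F -> riesz p q G -> riesz p q (fun x => F x * G x).
Proof.
move=> rF rG; have [K K0 FK] := riesz_bounded rF; have [L L0 GL] := riesz_bounded rG.
have [M acM FM] := rF; have [N acN GN] := rG.
exists (fun x => 2 * L ^+ 2 * M x + 2 * K ^+ 2 * N x).
  by apply: ac_familiesD; exact: ac_familiesZ.
move=> x y px xy yq.
have hF := FM _ _ px xy yq; have hG := GN _ _ px xy yq.
have Kx : F x ^+ 2 <= K ^+ 2.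
  by rewrite -real_normK ?num_real// ler_pXn2r ?nnegrE ?(ltW K0)// FK// (le_trans xy).
have Ly : G y ^+ 2 <= L ^+ 2.
  by rewrite -real_normK ?num_real// ler_pXn2r ?nnegrE ?(ltW L0)// GL// (le_trans px).
have h : (F y * G y - F x * G x) ^+ 2 <=
    2 * (G y ^+ 2 * (F y - F x) ^+ 2) + 2 * (F x ^+ 2 * (G y - G x) ^+ 2).
  have := sqr_ge0 (G y * (F y - F x) - F x * (G y - G x)); nra.
have hF' : G y ^+ 2 * (F y - F x) ^+ 2 <= L ^+ 2 * ((y - x) * (M y - M x)).
  by apply: ler_pM; rewrite ?sqr_ge0.
have hG' : F x ^+ 2 * (G y - G x) ^+ 2 <= K ^+ 2 * ((y - x) * (N y - N x)).
  by apply: ler_pM; rewrite ?sqr_ge0.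
lra.
Qed.

(** The increment of the reciprocal is that of [F] divided by [- F x F y], of modulus at least
    [c^2]; squaring gives the constant [c^-4]. *)
Lemma rieszV p q F (c : R) : 0 < c -> (forall x, p <= x -> x <= q -> c <= F x) ->
  riesz p q F -> riesz p q (fun x => (F x)^-1).
Proof.
move=> c0 cF [M acM FM]; exists (fun x => (c ^- 4) * M x); first exact: ac_familiesZ.
move=> x y px xy yq; have cx : c <= F x by rewrite cF// (le_trans xy).
have cy : c <= F y by rewrite cF// (le_trans px).
have Fx : 0 < F x by exact: lt_le_trans cx.
have Fy : 0 < F y by exact: lt_le_trans cy.
have -> : ((F y)^-1 - (F x)^-1) ^+ 2 = (F x * F y) ^- 2 * (F y - F x) ^+ 2.
  by field; rewrite !gt_eqF.
have -> : (y - x) * (c ^- 4 * M y - c ^- 4 * M x) = c ^- 4 * ((y - x) * (M y - M x)) by ring.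
apply: ler_pM; rewrite ?sqr_ge0 ?invr_ge0 ?sqr_ge0//; last exact: FM.
rewrite lef_pV2 ?posrE ?exprn_gt0 ?mulr_gt0//.
have -> : c ^+ 4 = (c * c) ^+ 2 by ring.
by rewrite ler_pXn2r ?nnegrE ?mulr_ge0 ?(ltW c0) ?(ltW Fx) ?(ltW Fy)// ler_pM// ltW.
Qed.

(** The Lipschitz bound on [psi] costs one factor [L], absorbed in the new primitive. *)
Lemma riesz_comp a b p q F (psi : R -> R) (L : R) : 0 < L ->
  (forall x, p <= x -> x <= q -> a <= psi x <= b) ->
  (forall x y, p <= x -> x <= y -> y <= q -> 0 <= psi y - psi x <= L * (y - x)) ->
  riesz a b F -> riesz p q (F \o psi).
Proof.
move=> L0 ab lip [M acM FM]; exists (fun x => L * (M (psi x))).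
  by apply: ac_familiesZ; exact: (ac_families_comp L0 ab lip acM).
move=> x y px xy yq; have /andP[h1 h2] := lip _ _ px xy yq.
have /andP[ax _] := ab x px (le_trans xy yq).
have /andP[_ yb] := ab y (le_trans px xy) yq.
have pxy : psi x <= psi y by rewrite -subr_ge0.
apply: (le_trans (FM _ _ ax pxy yb)).
have := riesz_le FM ax pxy yb; rewrite -subr_ge0 => M0.
have : (psi y - psi x) * (M (psi y) - M (psi x)) <= (L * (y - x)) * (M (psi y) - M (psi x)).
  exact: ler_wpM2r.
lra.
Qed.

Lemma riesz_glue p b q F : p <= b -> b <= q -> riesz p b F -> riesz b q F -> riesz p q F.
Proof.
move=> pb bq [M acM FM] [N acN FN].
(* [M] is frozen to the right of [b] and [N] to the left of it; only an interval with [b] in its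
   interior sees both vary. *)
exists (fun x => M (Num.min x b) + N (Num.max x b)).
  apply: ac_familiesD.
    apply: (@ac_families_comp _ p b _ _ _ (fun x => Num.min x b) 1) => //.
      by move=> x px xq; rewrite le_min px pb ge_min lexx orbT.
    move=> x y px xy yq; have [] := leP x b; have [] := leP y b; move=> h1 h2;
      apply/andP; split; lra.
  apply: (@ac_families_comp _ b q _ _ _ (fun x => Num.max x b) 1) => //.
    by move=> x px xq; rewrite ge_max xq bq le_max lexx orbT.
  move=> x y px xy yq; have [] := leP x b; have [] := leP y b; move=> h1 h2;
    apply/andP; split; lra.
move=> x y px xy yq.
have [yb|/ltW yb] := leP y b.
  rewrite (min_idPl (le_trans xy yb)) (max_idPr (le_trans xy yb)).
  by have := FM x y px xy yb; lra.
have [xb|/ltW xb] := leP x b; last first.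
  by have := FN x y xb xy yq; lra.
have h1 := FM _ _ px xb (lexx b); have h2 := FN _ _ (lexx b) yb yq.
have M0 := riesz_le FM px xb (lexx b); have N0 := riesz_le FN (lexx b) yb yq.
have -> : M b + N y - (M x + N b) = (M b - M x) + (N y - N b) by ring.
have -> : F y - F x = (F y - F b) + (F b - F x) by ring.
have -> : y - x = (y - b) + (b - x) by ring.
have u0 : 0 <= b - x by rewrite subr_ge0.
have v0 : 0 <= y - b by rewrite subr_ge0.
have s0 : 0 <= M b - M x by rewrite subr_ge0.
have t0 : 0 <= N y - N b by rewrite subr_ge0.
have := sqr_add_le_mul u0 v0 s0 t0 h1 h2; lra.
Qed.

End riesz_class.

(** * Almost everywhere properties *)

Section almost_everywhere.
Context {R : realType}.
Notation mu := (@lebesgue_measure R).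

Lemma aeS (P Q : R -> Prop) : (forall x, P x -> Q x) ->
  {ae mu, forall x, P x} -> {ae mu, forall x, Q x}.
Proof. by apply: filterS; exact: (ae_filter_ringOfSetsType mu). Qed.

Lemma aeS2 (P Q S : R -> Prop) : (forall x, P x -> Q x -> S x) ->
  {ae mu, forall x, P x} -> {ae mu, forall x, Q x} -> {ae mu, forall x, S x}.
Proof. by apply: filterS2; exact: (ae_filter_ringOfSetsType mu). Qed.

Lemma ae_neq (c : R) : {ae mu, forall x, x != c}.
Proof.
apply: (@negligibleS _ _ _ mu [set c]) => [x /= /negP/negPn/eqP//|].
by exists [set c]; split => //; exact: lebesgue_measure_set1.
Qed.

Lemma ae_segment (a b : R) (P : R -> Prop) :
  {ae mu, forall x, x \in `]a, b[ -> P x} -> {ae mu, forall x, x \in `[a, b] -> P x}.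
Proof.
move=> h; apply: (aeS2 _ h (aeS2 (fun x xa xb => conj xa xb) (ae_neq a) (ae_neq b))).
move=> x hx [xa xb]; rewrite in_itv/= => /andP[ax bx]; apply: hx.
by rewrite in_itv/= !lt_neqAle ax bx xb eq_sym xa.
Qed.

(** Measurability of [g] is asked for separately, since equality almost everywhere does not transfer
    Borel measurability. *)
Lemma ae_integrable (A : set R) (f g : R -> R) : measurable A -> measurable_fun A g ->
  {ae mu, forall x, x \in A -> f x = g x} -> mu.-integrable A (EFin \o f) ->
  mu.-integrable A (EFin \o g) /\
  \int[mu]_(x in A) f x = \int[mu]_(x in A) g x.
Proof.
move=> mA mg fg intf; have mf := measurable_integrable intf.
have aefg : ae_eq mu A (EFin \o f) (EFin \o g).
  by apply: aeS fg => x fgx Ax /=; rewrite fgx// inE.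
split; last first.
  by congr fine; apply: ae_eq_integral => //; exact/measurable_EFinP.
apply/integrableP; split; first exact/measurable_EFinP.
have /integrableP[_] := intf.
suff <- : (\int[mu]_(x in A) `|(EFin \o f) x| = \int[mu]_(x in A) `|(EFin \o g) x|)%E by [].
apply: ae_eq_integral => //.
- by apply: measurableT_comp => //; exact/measurable_EFinP.
- by apply: measurableT_comp => //; exact/measurable_EFinP.
- by apply: aeS aefg => x h Ax; rewrite /=; have [->] := h Ax.
Qed.

End almost_everywhere.

(** * The fundamental theorem of calculus for absolutely continuous functions *)

Section derivative_of_absolutely_continuous.
Context {R : realType}.
Notation mu := (@lebesgue_measure R).
Implicit Types (a b p q : R) (F G M : R -> R).

(** [G] is constrained only where [F] is differentiable, which is almost everywhere; a derivative
    with default values elsewhere qualifies. *)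
Theorem ac_families_FTC a b F G : a < b -> ac_families a b F ->
  measurable_fun `[a, b] G ->
  {ae mu, forall x, x \in `]a, b[ -> forall l, is_derive x 1 F l -> G x = l} ->
  mu.-integrable `[a, b] (EFin \o G) /\
  forall x, a <= x -> x <= b -> F x - F a = \int[mu]_(t in `[a, x]) G t.
Proof.
move=> ab acF mG hG; have [g [intg Fg dF]] := ac_families_density ab acF.
have gG : {ae mu, forall x, x \in `[a, b] -> g x = G x}.
  apply: ae_segment; apply: aeS2 hG dF => x hGx dFx xab.
  by rewrite (hGx xab _ (dFx xab)).
have mab : measurable `[a, b]%classic by exact: measurable_itv.
have [|intG _] := ae_integrable (f := g) mab mG _ intg.
  by apply: aeS gG => x h; rewrite inE => /h.
split => // x ax xb; rewrite Fg//.
have sub : `[a, x]%classic `<=` `[a, b]%classic by apply: subset_itvl; rewrite bnd_simp.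
have max : measurable `[a, x]%classic by exact: measurable_itv.
apply: (ae_integrable max _ _ (integrable_itvS sub intg)).2.
  exact: measurable_funS mG.
by apply: aeS gG => t h; rewrite inE => /sub /h.
Qed.

Lemma ac_families_ae_derive a b F : a < b -> ac_families a b F ->
  {ae mu, forall x, x \in `]a, b[ -> derivable F x 1}.
Proof.
move=> ab acF; have [g [_ _]] := ac_families_density ab acF.
by apply: aeS => x h /h[].
Qed.

(** The primitive of [G ^ 2] serves as [M], by the Cauchy-Schwarz inequality [sqr_Rintegral_le]. *)
Lemma riesz_of_derivative a b F G : a < b -> ac_families a b F ->
  sq_integrable `[a, b] G ->
  (forall x l, x \in `]a, b[ -> is_derive x 1 F l -> G x = l) -> riesz a b F.
Proof.
move=> ab acF sG hG; have [mG G2] := (sq_integrableP _ _).1 sG.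
have [|intG FG] := ac_families_FTC ab acF mG.
  (* [hG] holds at every point; [ae_neq a] merely provides an almost everywhere property to
     weaken. *)
  by apply: aeS (ae_neq a) => x _ xab l; exact: hG.
exists (fun x => \int[mu]_(t in `[a, x]) G t ^+ 2); first exact: ac_families_Rintegral.
move=> x y ax xy yb; have ay := le_trans ax xy.
have sub : `[a, y]%classic `<=` `[a, b]%classic by apply: subset_itvl; rewrite bnd_simp.
have subxy : `[x, y]%classic `<=` `[a, b]%classic.
  by apply: subset_itvScc; rewrite bnd_simp.
have -> : F y - F x = \int[mu]_(t in `[x, y]) G t.
  rewrite -[F y](subrK (F a)) -addrA -[F a - _]opprB !FG ?(le_trans xy)//.
  rewrite Rintegral_itvB//; last exact: integrable_itvS intG.
  rewrite Rintegral_itv_obnd_cbnd//; apply: integrable_itvS intG.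
  by apply: subset_trans subxy; apply: subset_itvr; rewrite bnd_simp.
rewrite Rintegral_itvB//; last exact: integrable_itvS G2.
rewrite Rintegral_itv_obnd_cbnd//; last first.
  apply: integrable_itvS G2.
  by apply: subset_trans subxy; apply: subset_itvr; rewrite bnd_simp.
apply: sqr_Rintegral_le => //.
by apply: sq_integrableS sG => //; exact: measurable_itv.
Qed.

(** The inequality is divided by [h ^ 2] before [h] tends to [0]. *)
Lemma sqr_derive_le (x : R) F M (l k : R) : is_derive x 1 F l -> is_derive x 1 M k ->
  (\forall h \near 0^'+, (F (x + h) - F x) ^+ 2 <= h * (M (x + h) - M x)) ->
  l ^+ 2 <= k.
Proof.
have H (N : R -> R) c : is_derive x 1 N c -> h^-1 * (N (x + h) - N x) @[h --> 0^'+] --> c.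
  move=> [dN <-]; have : h^-1 *: (N (h *: 1 + x) - N x) @[h --> 0^'] --> 'D_1 N x by exact: dN.
  have -> : (fun h => h^-1 * (N (x + h) - N x)) = (fun h => h^-1 *: (N (h *: 1 + x) - N x)).
    by apply/funext => h; rewrite [h *: 1]mulr1 [h + x]addrC.
  exact: cvg_dnbhs_at_right.
move=> /H dF /H dM FM; rewrite expr2.
apply: ler_cvg_to (cvgM dF dF) dM _.
near=> h; have h0 : 0 < h by near: h; exact: nbhs_right_gt.
rewrite /= -expr2 exprMn.
have -> : h^-1 * (M (x + h) - M x) = h^-1 ^+ 2 * (h * (M (x + h) - M x)).
  by rewrite expr2 -mulrA (mulrA h^-1 h) mulVf ?mul1r// gt_eqF.
by apply: ler_wpM2l; [rewrite sqr_ge0|near: h].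
Unshelve. all: by end_near. Qed.

(** Converse of [riesz_of_derivative]: almost everywhere the square of [F'] is at most [M'], which
    is integrable. *)
Lemma riesz_sq_integrable p q F : p < q -> riesz p q F ->
  measurable_fun `[p, q] (derive1 F) -> sq_integrable `[p, q] (derive1 F).
Proof.
move=> pq rF mF'; have [M acM FM] := rF.
have [h [inth _ dM]] := ac_families_density pq acM.
have mpq : measurable `[p, q]%classic by exact: measurable_itv.
apply/sq_integrableP; split => //.
have mh := measurable_integrable inth.
have nh : mu.-integrable `[p, q] (EFin \o (fun x => `|h x|)) by exact: integrable_norm inth.
(* This minimum is at most [|h|] everywhere, hence integrable, and it is the squared derivative
   almost everywhere. *)
suff kz : {ae mu, forall x, x \in `[p, q] -> Num.min (derive1 F x ^+ 2) `|h x| = derive1 F x ^+ 2}.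
  apply: (ae_integrable (f := fun x => Num.min (derive1 F x ^+ 2) `|h x|) mpq _ _ _).1.
  - exact: measurable_funX.
  - by apply: aeS kz => x + xpq; apply; rewrite inE in xpq.
  - apply: le_integrable_EFin nh => //.
      apply: measurable_minr; first exact: measurable_funX.
      exact: measurableT_comp.
    move=> x _; rewrite ger0_norm ?le_min ?sqr_ge0 ?normr_ge0//.
    by rewrite normr_id ge_min lexx orbT.
apply: ae_segment; apply: aeS2 dM (ac_families_ae_derive pq (riesz_ac rF)).
move=> x dMx dFx xpq; apply/min_idPl/(le_trans _ (ler_norm _)).
apply: (@sqr_derive_le x F M _ _ _ (dMx xpq)).
  by apply: DeriveDef; [exact: dFx|rewrite derive1E].
move: xpq; rewrite in_itv/= => /andP[px xq].
near=> e; have e0 : 0 < e by near: e; exact: nbhs_right_gt.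
have -> : e * (M (x + e) - M x) = (x + e - x) * (M (x + e) - M x) by rewrite addrAC subrr add0r.
apply: FM; first exact: ltW.
  by rewrite lerDl ltW.
by rewrite -lerBrDl; near: e; apply: nbhs_right_le; rewrite subr_gt0.
Unshelve. all: by end_near. Qed.

End derivative_of_absolutely_continuous.

(** * Measurability of the derivative of a continuous function *)

Section measurability_of_the_derivative.
Context {R : realType}.

(** The points of differentiability form a Borel set by the Cauchy criterion. On it the derivative
    is the limit of the continuous quotients with increments [1 / (n + 1)]; off it [lim] takes a
    constant default value. *)
Lemma measurable_derive1 (F : R -> R) : continuous F -> measurable_fun setT (derive1 F).
Proof.
move=> cF.
pose dq x h := h^-1 * (F (h + x) - F x).
(* Cauchy condition with tolerance [1 / (k + 1)] for increments below [1 / (n + 1)]. Although it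
   quantifies over uncountably many increments, it defines a closed set, as an intersection of
   closed sets. *)
pose C k n := [set x | forall h h' : R, h != 0 -> h' != 0 -> `|h| < n.+1%:R^-1 ->
   `|h'| < n.+1%:R^-1 -> `|dq x h - dq x h'| <= k.+1%:R^-1].
have cdq h : continuous (dq ^~ h).
  move=> x; apply: cvgM; first exact: cvg_cst.
  apply: cvgB; last exact: cF.
  apply: (@continuous_comp _ _ _ (fun x => h + x) F); last exact: cF.
  by apply: cvgD; [exact: cvg_cst|exact: cvg_id].
have clC k n : closed (C k n).
  have -> : C k n = \bigcap_(hh in [set hh : R * R | [/\ hh.1 != 0, hh.2 != 0,
      `|hh.1| < n.+1%:R^-1 & `|hh.2| < n.+1%:R^-1]])
      ((fun x => `|dq x hh.1 - dq x hh.2|) @^-1` [set y | y <= k.+1%:R^-1]).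
    apply/seteqP; split=> [x Cx [h h'] [/= h1 h2 h3 h4]|x Cx h h' h1 h2 h3 h4]; first exact: Cx.
    by apply: (Cx (h, h')).
  apply: closed_bigI => -[h h'] _; apply: preimage_closed; last exact: closed_le.
  by move=> x _; apply: cvg_norm; apply: cvgB; exact: cdq.
pose D := \bigcap_k \bigcup_n C k n.
have mD : measurable D.
  apply: bigcap_measurable; first by exists 0%N.
  move=> k _; apply: bigcup_measurable => n _.
  by apply: closed_measurable; exact: clC.
have dE x : (h^-1 *: (F (h + x) - F x) @[h --> 0^']) = (dq x h @[h --> 0^']) by [].
have DE x : D x <-> cvg (dq x h @[h --> 0^']).
  split=> [Dx|/cvg_ex[l dl] k _].
    apply/cauchy_cvgP; apply: cauchy_exP => e e0.
    have [k ke] : exists k : nat, k.+1%:R^-1 < e.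
      by have [k _ /(_ k (leqnn k))] := near_infty_natSinv_lt (PosNum e0); exists k.
    have [n _ Cx] := Dx k Logic.I.
    have n0 : 0 < n.+2%:R^-1 :> R by rewrite invr_gt0.
    exists (dq x n.+2%:R^-1); apply/nbhs_ballP; exists n.+1%:R^-1; first by rewrite /= invr_gt0.
    move=> h; rewrite /ball/= sub0r normrN => hn h0; apply: le_lt_trans ke.
    by apply: Cx => //; rewrite gtr0_norm// ltf_pV2 ?posrE// ltr_nat.
  have e0 : 0 < k.+1%:R^-1 / 2 :> R by rewrite divr_gt0 ?invr_gt0.
  move/cvgrPdist_lt : dl => /(_ _ e0)/nbhs_ballP[r /= r0 rl].
  have [n _ /(_ n (leqnn n)) nr] := near_infty_natSinv_lt (PosNum r0).
  exists n => // h h' h0 h'0 hn h'n.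
  have l1 : `|l - dq x h| < k.+1%:R^-1 / 2.
    by apply: rl => //; rewrite /ball/= sub0r normrN; exact: lt_trans nr.
  have l2 : `|l - dq x h'| < k.+1%:R^-1 / 2.
    by apply: rl => //; rewrite /ball/= sub0r normrN; exact: lt_trans nr.
  have -> : dq x h - dq x h' = (l - dq x h') - (l - dq x h) by ring.
  by rewrite [leRHS]splitr (le_trans (ler_normB _ _))// lerD// ltW.
have mlim : measurable_fun D (derive1 F).
  apply: (@measurable_fun_cvg _ _ _ _ (fun n x => dq x n.+1%:R^-1)).
    move=> n; apply: (measurable_funS measurableT) => //.
    by apply: continuous_measurable_fun; exact: cdq.
  move=> x /DE dx; rewrite /derive1 dE.
  move/cvgr_dnbhsP : dx; apply; split => [n|].
    by rewrite gt_eqF// invr_gt0.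
  exact: cvg_harmonic.
have mcst : measurable_fun (~` D) (derive1 F).
  apply: (@eq_measurable_fun _ _ _ _ _ (fun=> point)); last exact: measurable_cst.
  move=> x; rewrite inE/= => nDx; rewrite /derive1 dE; apply/esym.
  by apply: dvgP => /DE.
rewrite -(setUv D); apply/measurable_funU => //.
by apply: measurableC.
Qed.

End measurability_of_the_derivative.

(** * Derivatives relative to a set *)

Section relative_derivative.
Context {R : realType}.
Implicit Types (A B : set R) (f g : R -> R) (x l : R).

#[local] Instance within_dnbhs_filter A x : Filter (within A x^').
Proof. exact: within_filter. Qed.

(** As a relation it needs no uniqueness of limits, so the rules of calculus hold for every set
    [A]. *)
Definition has_deriv_in A f x l : Prop := diff_quot f x y @[y --> within A x^'] --> l.

Lemma has_deriv_inP A f x l : has_deriv_in A f x l <->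
  forall e : R, 0 < e -> exists2 d : R, 0 < d &
    forall y, A y -> y != x -> `|y - x| < d -> `|diff_quot f x y - l| < e.
Proof.
split=> [/cvgrPdist_lt h e /h|h].
  move=> /nbhs_ballP[d /= d0 hd]; exists d => // y Ay yx yxd.
  by rewrite distrC; apply: hd => //; rewrite /ball/= distrC.
apply/cvgrPdist_lt => e /h[d d0 hd]; apply/nbhs_ballP; exists d => // y.
by rewrite /ball/= distrC => yxd yx Ay; rewrite distrC; exact: hd.
Qed.

Lemma derivable_in_has A f x : derivable_in A f x -> has_deriv_in A f x (derive_in A f x).
Proof. by []. Qed.

Lemma has_deriv_inW A B f x l (d : R) : 0 < d ->
  (forall y, B y -> `|y - x| < d -> A y) -> has_deriv_in A f x l -> has_deriv_in B f x l.
Proof.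
move=> d0 BA /has_deriv_inP h; apply/has_deriv_inP => e /h[d' d'0 hd'].
exists (Num.min d d'); first by rewrite lt_min d0.
by move=> y By yx; rewrite lt_min => /andP[yd yd']; apply: hd' => //; exact: BA.
Qed.

Lemma has_deriv_inU A B f x l :
  has_deriv_in A f x l -> has_deriv_in B f x l -> has_deriv_in (A `|` B) f x l.
Proof.
move=> /has_deriv_inP hA /has_deriv_inP hB; apply/has_deriv_inP => e e0.
have [d d0 hd] := hA _ e0; have [d' d'0 hd'] := hB _ e0.
exists (Num.min d d'); first by rewrite lt_min d0.
by move=> y [Ay|By] yx; rewrite lt_min => /andP[yd yd']; [exact: hd|exact: hd'].
Qed.

Lemma eq_has_deriv_in A f g x l : f x = g x -> (forall y, A y -> f y = g y) ->
  has_deriv_in A f x l -> has_deriv_in A g x l.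
Proof.
move=> fgx fg /has_deriv_inP h; apply/has_deriv_inP => e /h[d d0 hd].
by exists d => // y Ay yx yxd; rewrite /diff_quot -fgx -fg//; exact: hd.
Qed.

Lemma has_deriv_in_cvg A f x l : has_deriv_in A f x l ->
  f y @[y --> within A x^'] --> f x.
Proof.
move=> h; have yx : y - x @[y --> within A x^'] --> (0 : R).
  rewrite -(subrr x); apply: cvgB; last exact: cvg_cst.
  by apply: cvg_trans (cvg_within _) _; exact: nbhs_dnbhs.
have : diff_quot f x y * (y - x) + f x @[y --> within A x^'] --> l * 0 + f x.
  by apply: cvgD; [exact: cvgM|exact: cvg_cst].
rewrite mulr0 add0r; apply: cvg_trans; apply: near_eq_cvg; apply: (cvg_within A).
near=> y; rewrite /= /diff_quot mulfVK ?subrK// subr_eq0.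
by near: y; exact: nbhs_dnbhs_neq.
Unshelve. all: by end_near. Qed.

Lemma has_deriv_in_cst A (c : R) x : has_deriv_in A (fun=> c) x 0.
Proof.
rewrite /has_deriv_in (_ : diff_quot _ x = fun=> 0); first exact: cvg_cst.
by apply/funext => y; rewrite /diff_quot subrr mul0r.
Qed.

Lemma has_deriv_in_id A x : has_deriv_in A id x 1.
Proof.
apply/has_deriv_inP => e e0; exists 1 => // y _ yx _.
by rewrite /diff_quot divff ?subr_eq0// subrr normr0.
Qed.

Lemma has_deriv_inD A f g x l k : has_deriv_in A f x l -> has_deriv_in A g x k ->
  has_deriv_in A (fun y => f y + g y) x (l + k).
Proof.
move=> hf hg; rewrite /has_deriv_in.
rewrite (_ : diff_quot _ x = fun y => diff_quot f x y + diff_quot g x y).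
  exact: cvgD hf hg.
by apply/funext => y; rewrite /diff_quot -mulrDl opprD addrACA.
Qed.

Lemma has_deriv_inM A f g x l k : has_deriv_in A f x l -> has_deriv_in A g x k ->
  has_deriv_in A (fun y => f y * g y) x (l * g x + f x * k).
Proof.
move=> hf hg; rewrite /has_deriv_in.
rewrite (_ : diff_quot _ x = fun y => diff_quot f x y * g y + f x * diff_quot g x y).
  apply: cvgD; first by apply: cvgM => //; exact: has_deriv_in_cvg hg.
  by apply: cvgM => //; exact: cvg_cst.
apply/funext => y; rewrite /diff_quot; ring.
Qed.

Lemma has_deriv_inV A f x l : f x != 0 -> (forall y, A y -> f y != 0) ->
  has_deriv_in A f x l -> has_deriv_in A (fun y => (f y)^-1) x (- (l * ((f x)^-1 * (f x)^-1))).
Proof.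
move=> fx0 f0 hf.
have : - (diff_quot f x y * ((f y)^-1 * (f x)^-1)) @[y --> within A x^'] -->
    - (l * ((f x)^-1 * (f x)^-1)).
  apply: cvgN; apply: cvgM => //; apply: cvgM; last exact: cvg_cst.
  by apply: cvgV => //; exact: has_deriv_in_cvg hf.
apply: cvg_trans; apply: near_eq_cvg.
rewrite near_withinE; near=> y => Ay; rewrite /diff_quot.
have yx : y - x != 0 by rewrite subr_eq0; near: y; exact: nbhs_dnbhs_neq.
by field; rewrite fx0 yx f0.
Unshelve. all: by end_near. Qed.

Lemma has_deriv_in_is_derive A f x l : nbhs x A -> has_deriv_in A f x l ->
  is_derive x 1 f l.
Proof.
move=> /nbhs_ballP[d /= d0 dA] h.
have : h^-1 *: (f (h *: 1 + x) - f x) @[h --> 0^'] --> l.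
  move/has_deriv_inP : h => h; apply/cvgrPdist_lt => e /h[d' d'0 hd'].
  apply/nbhs_ballP; exists (Num.min d d'); first by rewrite /= lt_min d0.
  move=> k; rewrite /ball/= sub0r normrN lt_min => /andP[kd kd'] k0.
  rewrite [k *: 1]mulr1 distrC.
  have -> : k^-1 *: (f (k + x) - f x) = diff_quot f x (k + x).
    by rewrite /diff_quot addrK mulrC.
  apply: hd'; rewrite ?addrK//; last by rewrite -subr_eq0 addrK.
  by apply: dA; rewrite /ball/= distrC addrK.
by move=> hl; apply: DeriveDef; [apply/cvg_ex; exists l|exact/cvg_lim].
Qed.

Lemma has_deriv_in_continuous A f (df : R -> R) :
  (forall x, A x -> has_deriv_in A f x (df x)) -> {within A, continuous f}.
Proof.
move=> hf; apply/subspace_continuousP => x Ax; apply/cvgrPdist_lt => e e0.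
have /cvgrPdist_lt /(_ _ e0) /nbhs_ballP[d /= d0 hd] := has_deriv_in_cvg (hf _ Ax).
apply/nbhs_ballP; exists d => // y xyd Ay; have [->|yx] := eqVneq y x.
  by rewrite subrr normr0.
exact: hd.
Qed.

Lemma has_deriv_in_MVT (p q : R) f (df : R -> R) x y :
  (forall x, p <= x -> x <= q -> has_deriv_in `[p, q] f x (df x)) ->
  p <= x -> x <= y -> y <= q ->
  exists c, [/\ x <= c, c <= y & f y - f x = df c * (y - x)].
Proof.
move=> hf px xy yq.
have sub : `[x, y]%classic `<=` `[p, q]%classic by apply: subset_itvScc; rewrite bnd_simp.
have [||c] := @MVT_segment R f df x y xy.
- move=> z; rewrite in_itv/= => /andP[xz zy].
  have pz : p <= z by exact: le_trans (ltW xz).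
  have zq : z <= q by exact: le_trans (ltW zy) yq.
  apply: has_deriv_in_is_derive (hf _ pz zq).
  apply: (@filterS _ _ _ `]x, y[%classic).
    by apply: subset_trans sub; exact: subset_itv_oo_cc.
  by apply: near_in_itvoo; rewrite in_itv/= xz.
- apply: continuous_subspaceW sub _; apply: (@has_deriv_in_continuous _ _ df).
  by move=> z; rewrite /= in_itv/= => /andP[pz zq]; exact: hf.
by rewrite in_itv/= => /andP[xc cy] fE; exists c.
Qed.

(** Since [phi (psi x) = x], the difference quotient of [h \o psi] is the quotient of those of [h]
    and [phi] at [psi y]. The Lipschitz bound makes [psi x] tend to [psi y], and injectivity keeps
    them distinct. *)
Lemma has_deriv_in_comp_inverse (p q a b : R) (h phi psi : R -> R) (dh dphi : R) (c y : R) :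
  0 < c ->
  (forall x, a <= x -> x <= b -> [/\ p <= psi x, psi x <= q & phi (psi x) = x]) ->
  (forall x x', a <= x -> x <= x' -> x' <= b -> 0 <= psi x' - psi x <= c * (x' - x)) ->
  a <= y -> y <= b -> dphi != 0 ->
  has_deriv_in `[p, q] phi (psi y) dphi -> has_deriv_in `[p, q] h (psi y) dh ->
  has_deriv_in `[a, b] (h \o psi) y (dh / dphi).
Proof.
move=> c0 psiK lip ay yb dphi0 hphi hh.
have norm_lip x x' : a <= x <= b -> a <= x' <= b -> `|psi x' - psi x| <= c * `|x' - x|.
  move=> /andP[ax xb] /andP[ax' x'b]; have [xx'|/ltW xx'] := leP x x'.
    have /andP[h1 h2] := lip _ _ ax xx' x'b.
    by rewrite ger0_norm// ger0_norm// subr_ge0.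
  have /andP[h1 h2] := lip _ _ ax' xx' xb.
  by rewrite distrC (distrC x') ger0_norm// ger0_norm// subr_ge0.
have psi_neq x : a <= x <= b -> x != y -> psi x != psi y.
  move=> /andP[ax xb]; apply: contra => /eqP pxy.
  by have [_ _ <-] := psiK _ ax xb; have [_ _ <-] := psiK _ ay yb; rewrite pxy.
have : diff_quot h (psi y) x / diff_quot phi (psi y) x @[x --> within `[p, q] (psi y)^']
    --> dh / dphi.
  by apply: cvgM => //; exact: cvgV.
move=> /cvgrPdist_lt H; apply/has_deriv_inP => e /H /nbhs_ballP[d /= d0 hd].
exists (d / c); first exact: divr_gt0.
move=> x; rewrite /= in_itv/= => axb xy xyd.
have [px xq xE] : [/\ p <= psi x, psi x <= q & phi (psi x) = x].
  by apply: psiK; case/andP: axb.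
have yab : a <= y <= b by rewrite ay yb.
have nxy := psi_neq _ axb xy.
rewrite distrC; have -> : diff_quot (h \o psi) y x =
    diff_quot h (psi y) (psi x) / diff_quot phi (psi y) (psi x).
  have [_ _ yE] := psiK _ ay yb.
  rewrite /diff_quot xE yE /=; field.
  by rewrite !subr_eq0 nxy xy.
apply: hd => //=; last by rewrite in_itv/= px xq.
rewrite /ball/= distrC; apply: le_lt_trans (norm_lip _ _ yab axb) _.
by rewrite mulrC -ltr_pdivlMr.
Qed.

End relative_derivative.

Section relative_derivative_on_segments.
Context {R : realType}.

Lemma is_derive_has_deriv_in (A : set R) (f : R -> R) (x l : R) :
  is_derive x 1 f l -> has_deriv_in A f x l.
Proof.
move=> [df fl]; apply/has_deriv_inP => e e0.
have : h^-1 *: (f (h *: 1 + x) - f x) @[h --> 0^'] --> l by rewrite -fl; exact: df.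
move/cvgrPdist_lt => /(_ _ e0)/nbhs_ballP[d /= d0 hd]; exists d => // y _ yx yxd.
rewrite distrC; have -> : diff_quot f x y = (y - x)^-1 *: (f ((y - x) *: 1 + x) - f x).
  by rewrite [(y - x) *: 1]mulr1 subrK /diff_quot mulrC.
by apply: hd; rewrite /ball/= ?sub0r ?normrN// subr_eq0.
Qed.

(** Every punctured neighbourhood of [x] meets the segment, on the right if [x < q] and on the left
    if [x = q], so the limit is unique. *)
Lemma derive_in_segment (p q : R) (f : R -> R) (x l : R) : p < q -> x \in `[p, q] ->
  has_deriv_in `[p, q] f x l -> derive_in `[p, q] f x = l.
Proof.
rewrite in_itv/= => pq /andP[px xq] hf.
suff PF : ProperFilter (within `[p, q] x^') by apply/cvg_lim.
apply: Build_ProperFilter => /nbhs_ballP[d /= d0 hd].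
have d2 : 0 < d / 2 by rewrite divr_gt0.
have [xq'|qx] := ltP x q.
  have h1 : Num.min (x + d / 2) q <= x + d / 2 by rewrite ge_min lexx.
  have h2 : x < Num.min (x + d / 2) q by rewrite lt_min xq' ltrDl d2.
  have h3 : Num.min (x + d / 2) q <= q by rewrite ge_min lexx orbT.
  apply: (hd (Num.min (x + d / 2) q)) => //=.
  - by rewrite /ball/= distrC ger0_norm; lra.
  - by rewrite gt_eqF.
  - by rewrite in_itv/= (le_trans px (ltW h2)).
have h1 : x - d / 2 <= Num.max (x - d / 2) p by rewrite le_max lexx.
have h2 : Num.max (x - d / 2) p < x by rewrite gt_max (lt_le_trans pq qx) andbT; lra.
have h3 : p <= Num.max (x - d / 2) p by rewrite le_max lexx orbT.
apply: (hd (Num.max (x - d / 2) p)) => //=.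
- by rewrite /ball/= ger0_norm; lra.
- by rewrite lt_eqF.
- by rewrite in_itv/= h3 (le_trans (ltW h2)).
Qed.

End relative_derivative_on_segments.

Arguments is_derive_has_deriv_in {R} A [f x l] _.

(** * Sobolev spaces on a segment *)

Section smooth_functions.
Context {R : realType}.
Implicit Types (p q a b : R) (f g : R -> R).

(* [sobolev_seg j p q] is H^(j+1)([p, q]). *)
Fixpoint sobolev_seg (j : nat) p q f : Prop :=
  if j is i.+1 then exists2 df : R -> R,
    (forall x, p <= x -> x <= q -> has_deriv_in `[p, q] f x (df x)) & sobolev_seg i p q df
  else riesz p q f.

(** For positive [j] the derivative is bounded, and the mean value theorem makes [f] Lipschitz. *)
Lemma sobolev_seg_riesz j p q f : sobolev_seg j p q f -> riesz p q f.
Proof.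
elim: j f => [//|j IH] f [df hf /IH rdf]; have [K K0 dfK] := riesz_bounded rdf.
apply: (@riesz_lipschitz _ _ _ _ K) => x y px xy yq.
have [c [xc cy ->]] := has_deriv_in_MVT hf px xy yq.
rewrite normrM (ger0_norm (_ : 0 <= y - x)) ?subr_ge0//.
by apply: ler_wpM2r; rewrite ?subr_ge0// dfK ?(le_trans px)// (le_trans cy).
Qed.

Lemma sobolev_segS j p q f : sobolev_seg j.+1 p q f -> sobolev_seg j p q f.
Proof.
elim: j f => [|j IH] f; first exact: sobolev_seg_riesz.
by move=> [df hf /IH sdf]; exists df.
Qed.

Lemma sobolev_seg_cst j p q (c : R) : sobolev_seg j p q (fun=> c).
Proof.
elim: j c => [|j IH] c; first exact: riesz_cst.
by exists (fun=> 0) => // x _ _; exact: has_deriv_in_cst.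
Qed.

Lemma sobolev_seg_id j p q : sobolev_seg j p q id.
Proof.
case: j => [|j].
  by apply: (@riesz_lipschitz _ _ _ _ 1) => x y _ xy _; rewrite mul1r ger0_norm// subr_ge0.
by exists (fun=> 1); [move=> x _ _; exact: has_deriv_in_id|exact: sobolev_seg_cst].
Qed.

Lemma sobolev_segD j p q f g : sobolev_seg j p q f -> sobolev_seg j p q g ->
  sobolev_seg j p q (fun x => f x + g x).
Proof.
elim: j f g => [|j IH] f g; first exact: rieszD.
move=> [df hf sf] [dg hg sg]; exists (fun x => df x + dg x); last exact: IH.
by move=> x px xq; apply: has_deriv_inD; [exact: hf|exact: hg].
Qed.

Lemma sobolev_segM j p q f g : sobolev_seg j p q f -> sobolev_seg j p q g ->
  sobolev_seg j p q (fun x => f x * g x).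
Proof.
elim: j f g => [|j IH] f g; first exact: rieszM.
move=> sf1 sg1; have sf := sobolev_segS sf1; have sg := sobolev_segS sg1.
have [df hf sdf] := sf1; have [dg hg sdg] := sg1.
exists (fun x => df x * g x + f x * dg x).
  by move=> x px xq; apply: has_deriv_inM; [exact: hf|exact: hg].
by apply: sobolev_segD; exact: IH.
Qed.

Lemma sobolev_segZ j p q (c : R) f : sobolev_seg j p q f ->
  sobolev_seg j p q (fun x => c * f x).
Proof. by apply: sobolev_segM; exact: sobolev_seg_cst. Qed.

Lemma sobolev_segV j p q f (c : R) : 0 < c -> (forall x, p <= x -> x <= q -> c <= f x) ->
  sobolev_seg j p q f -> sobolev_seg j p q (fun x => (f x)^-1).
Proof.
move=> c0 cf; elim: j => [|j IH]; first exact: (rieszV c0 cf).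
move=> sf1; have sf := sobolev_segS sf1; have [df hf sdf] := sf1.
have f0 x : p <= x -> x <= q -> f x != 0.
  by move=> px xq; rewrite gt_eqF// (lt_le_trans c0)// cf.
exists (fun x => - 1 * (df x * ((f x)^-1 * (f x)^-1))).
  move=> x px xq; rewrite mulN1r; apply: has_deriv_inV; [exact: f0| |exact: hf].
  by move=> y; rewrite /= in_itv/= => /andP[]; exact: f0.
by apply: sobolev_segZ; apply: sobolev_segM => //; apply: sobolev_segM; exact: IH.
Qed.

(** The derivative of [f \o psi] is [(df / dphi) \o psi], so the induction passes from [f] to
    [df / dphi]. The hypothesis on [dphi] is indexed to ask for one order less than for [f], and for
    nothing at [j = 0]. *)
Lemma sobolev_seg_comp_inverse j p q a b (phi dphi psi f : R -> R) (c : R) : 0 < c ->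
  (forall x, p <= x -> x <= q -> has_deriv_in `[p, q] phi x (dphi x)) ->
  (forall x, p <= x -> x <= q -> c <= dphi x) ->
  (forall i, i.+1 = j -> sobolev_seg i p q dphi) ->
  (forall x, a <= x -> x <= b -> [/\ p <= psi x, psi x <= q & phi (psi x) = x]) ->
  (forall x y, a <= x -> x <= y -> y <= b -> 0 <= psi y - psi x <= c^-1 * (y - x)) ->
  sobolev_seg j p q f -> sobolev_seg j a b (f \o psi).
Proof.
move=> c0 hphi cphi + psiK lip; have c'0 : 0 < c^-1 by rewrite invr_gt0.
elim: j f => [|j IH] f sphi.
  apply: riesz_comp c'0 _ lip => x ax xb.
  by have [-> ->] := psiK x ax xb.
move=> [df hf sdf]; have sdphi := sphi _ erefl.
exists ((fun x => df x * (dphi x)^-1) \o psi); last first.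
  apply: IH => [i ij|]; first by subst j; exact: sobolev_segS.
  by apply: sobolev_segM => //; exact: sobolev_segV c0 cphi _.
move=> y ay yb; have [ppsi psiq _] := psiK _ ay yb.
apply: has_deriv_in_comp_inverse c'0 psiK lip ay yb _ (hphi _ ppsi psiq) (hf _ ppsi psiq).
by rewrite gt_eqF// (lt_le_trans c0)// cphi.
Qed.

Lemma sobolev_seg_jets j p q f : sobolev_seg j p q f ->
  exists d : nat -> R -> R, [/\ d 0%N = f,
    forall k, (k < j)%N -> forall x, p <= x -> x <= q -> has_deriv_in `[p, q] (d k) x (d k.+1 x) &
    forall k, (k <= j)%N -> riesz p q (d k)].
Proof.
elim: j f => [|j IH] f.
  by move=> rf; exists (fun=> f); split => // k; rewrite leqn0 => /eqP ->.
move=> sf; have [df hf /IH[d [d0 hd rd]]] := sf.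
exists (fun k => if k is i.+1 then d i else f); split => // -[|k] kj.
- by move=> x px xq; rewrite d0; exact: hf.
- exact: hd.
- exact: sobolev_seg_riesz sf.
- exact: rd.
Qed.

End smooth_functions.

Section sobolev01.
Context {R : realType}.

(** The derivative of order [m.+1] takes default values where that of order [m] is not
    differentiable, which [riesz_of_derivative] accepts. The lower orders are then stacked on top by
    induction. *)
Lemma sobolev01_seg (m : nat) (f : R -> R) : f \in sobolev01 R m.+1 -> sobolev_seg m 0 1 f.
Proof.
rewrite inE => -[/= df acf sf].
have rf : riesz 0 1 (deriven_in `[0, 1] m f).
  apply: riesz_of_derivative (ltr01) _ sf _; first exact/abs_continuousP.
  move=> x l x01 dl; rewrite /= /derive_in.
  apply: derive_in_segment; rewrite ?ltr01//; last exact: is_derive_has_deriv_in.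
  by move: x01; rewrite !in_itv/= => /andP[/ltW -> /ltW ->].
have H i : forall k, (i + k = m)%N -> sobolev_seg i 0 1 (deriven_in `[0, 1] k f).
  elim: i => [k|i IH k ikm]; first by rewrite add0n => ->.
  exists (deriven_in `[0, 1] k.+1 f); last by apply: IH; rewrite addnS -addSn.
  move=> x x0 x1; apply: derivable_in_has; apply: df; last by rewrite in_itv/= x0.
  by rewrite -ikm addSn ltnS leq_addl.
by apply: (H m 0%N); rewrite addn0.
Qed.

End sobolev01.

(** * The prescribed velocity on the image of the segment *)

Section velocity_on_the_image.
Context {R : realType}.

Lemma ac_families_continuous (p q : R) (F : R -> R) :
  ac_families p q F -> {within `[p, q], continuous F}.
Proof.
move=> acF; apply/subspace_continuousP => x; rewrite /= in_itv/= => /andP[px xq].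
apply/cvgrPdist_lt => e e0; have [d d0 dF] := ac_families_within_continuous acF e0.
apply/nbhs_ballP; exists d => // y; rewrite /ball/= => xyd; rewrite in_itv/= => /andP[py yq].
have [xy|/ltW yx] := leP x y.
  by rewrite distrC; apply: dF => //; rewrite -[_ - _]ger0_norm ?subr_ge0// distrC.
by apply: dF => //; rewrite -[_ - _]ger0_norm ?subr_ge0.
Qed.

Lemma velocity_on_image (m : nat) (f : R -> R) (t : R) : f \in sobolev01 R m.+2 ->
  (forall x : R, x \in `[0, 1] -> 0 < derive_in `[0, 1] f x) -> t \in `[0, 1] ->
  exists a b g, [/\ a < b, sobolev_seg m.+1 a b g,
    (forall x, x \in `[0, 1] -> a <= phi f t x <= b /\ g (phi f t x) = f x - x) &
    (forall y, a <= y -> y <= b -> exists2 x, x \in `[0, 1] & phi f t x = y)].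
Proof.
move=> /sobolev01_seg sf df0; rewrite in_itv/= => /andP[t0 t1].
have [df hf sdf] := sf.
have dfE (x : R) : 0 <= x -> x <= 1 -> derive_in `[0, 1] f x = df x.
  move=> x0 x1; apply: derive_in_segment => //; first by rewrite in_itv/= x0.
  exact: hf.
have [c0 c001 cmin] := EVT_min ler01 (ac_families_continuous (riesz_ac (sobolev_seg_riesz sdf))).
(* The derivative of [phi f t] is a convex combination of [f'] and [1], so [c] bounds it below for
   every [t]. *)
pose c := Num.min (df c0) 1.
have c_gt0 : 0 < c.
  rewrite lt_min ltr01 andbT; move: (c001); rewrite in_itv/= => /andP[? ?].
  by rewrite -dfE// df0.
have c1 : c <= 1 by rewrite ge_min lexx orbT.
have cdf (x : R) : 0 <= x -> x <= 1 -> c <= df x.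
  by move=> x0 x1; rewrite ge_min cmin// in_itv/= x0.
pose dphi x := t * df x + (1 - t) * 1.
have hphi (x : R) : 0 <= x -> x <= 1 -> has_deriv_in `[0, 1] (phi f t) x (dphi x).
  move=> x0 x1; apply: has_deriv_inD.
    have := has_deriv_inM (has_deriv_in_cst `[0, 1]%classic t x) (hf x x0 x1).
    by rewrite mul0r add0r.
  have := has_deriv_inM (has_deriv_in_cst `[0, 1]%classic (1 - t) x)
    (has_deriv_in_id `[0, 1]%classic x).
  by rewrite mul0r add0r.
have cdphi (x : R) : 0 <= x -> x <= 1 -> c <= dphi x.
  move=> x0 x1; have h1 := ler_wpM2l t0 (cdf _ x0 x1).
  have h2 : (1 - t) * c <= (1 - t) * 1 by apply: ler_wpM2l => //; rewrite subr_ge0.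
  by rewrite /dphi; lra.
have sdphi : sobolev_seg m 0 1 dphi.
  by apply: sobolev_segD; [exact: sobolev_segZ|exact: sobolev_seg_cst].
have grow (x y : R) : 0 <= x -> x <= y -> y <= 1 -> c * (y - x) <= phi f t y - phi f t x.
  move=> x0 xy y1; have [z [xz zy ->]] := has_deriv_in_MVT hphi x0 xy y1.
  by apply: ler_wpM2r; rewrite ?subr_ge0// cdphi ?(le_trans x0)// (le_trans zy).
have mono (x y : R) : 0 <= x -> x <= y -> y <= 1 -> phi f t x <= phi f t y.
  move=> x0 xy y1; rewrite -subr_ge0; apply: le_trans (grow _ _ x0 xy y1).
  by rewrite mulr_ge0 ?(ltW c_gt0)// subr_ge0.
have inj (x y : R) : 0 <= x -> 0 <= y -> x <= 1 -> y <= 1 -> phi f t x <= phi f t y -> x <= y.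
  move=> x0 y0 x1 y1 pxy; rewrite leNgt; apply/negP => yx.
  have := grow _ _ y0 (ltW yx) x1; have : 0 < c * (x - y) by rewrite mulr_gt0 ?subr_gt0.
  lra.
set a := phi f t 0; set b := phi f t 1.
have ab : a < b.
  by have := grow _ _ (lexx 0) ler01 (lexx 1); rewrite subr0 mulr1 -/a -/b; lra.
have surj y : a <= y -> y <= b -> exists x : R, [/\ 0 <= x, x <= 1 & phi f t x = y].
  move=> ay yb; have [||x] := @IVT R (phi f t) 0 1 y ler01.
  - apply: (@has_deriv_in_continuous _ _ _ dphi) => x; rewrite /= in_itv/= => /andP[x0 x1].
    exact: hphi.
  - by rewrite -/a -/b (min_idPl (ltW ab)) (max_idPr (ltW ab)) ay yb.
  by rewrite in_itv/= => /andP[x0 x1] <-; exists x.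
(* The inverse of [phi f t] on [[a, b]], obtained pointwise by choice from surjectivity. *)
have /choice[psi psiP] : forall y, exists x : R,
    a <= y -> y <= b -> [/\ 0 <= x, x <= 1 & phi f t x = y].
  move=> y; have [[ay yb]|nab] := pselect (a <= y /\ y <= b).
    by have [x ?] := surj y ay yb; exists x.
  by exists 0 => ay yb; case: nab.
have sg : sobolev_seg m.+1 a b ((fun x => f x + - 1 * x) \o psi).
  apply: (sobolev_seg_comp_inverse c_gt0 hphi cdphi _ psiP).
  - by move=> i [->].
  - move=> x y ax xy yb; have [x0 x1 xE] := psiP _ ax (le_trans xy yb).
    have [y0 y1 yE] := psiP _ (le_trans ax xy) yb.
    have pxy : psi x <= psi y by apply: inj; rewrite ?xE ?yE.
    rewrite subr_ge0 pxy/= mulrC ler_pdivlMr// mulrC.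
    by have := grow _ _ x0 pxy y1; rewrite xE yE.
  - by apply: sobolev_segD => //; apply: sobolev_segZ; exact: sobolev_seg_id.
exists a, b, ((fun x => f x + - 1 * x) \o psi); split; [exact: ab|exact: sg| |].
- move=> x; rewrite in_itv/= => /andP[x0 x1].
  have ax : a <= phi f t x by exact: mono.
  have xb : phi f t x <= b by exact: mono.
  rewrite ax xb; split => //=.
  have [p0 p1 pE] := psiP _ ax xb.
  have -> : psi (phi f t x) = x by apply/le_anti/andP; split; apply: inj; rewrite ?pE.
  by rewrite mulN1r.
- move=> y ay yb; have [x [x0 x1 xE]] := surj _ ay yb.
  by exists x => //; rewrite in_itv/= x0.
Qed.

End velocity_on_the_image.

(** * Exponential solutions and their decay *)

Section complex_exponential.
Context {R : realType}.

Definition cexp (w : R[i]) (x : R) : R[i] :=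
  (expR (complex.Re w * x) * cos (complex.Im w * x) +i*
   (expR (complex.Re w * x) * sin (complex.Im w * x)))%C.

(** Differentiation multiplies the coefficient [z] by [w], so that derivatives of all orders keep
    this form. *)
Lemma is_derive_Re_cexp (z w : R[i]) (x : R) :
  is_derive x 1 (fun x => complex.Re (z * cexp w x)) (complex.Re (z * w * cexp w x)).
Proof.
case: z w => [z1 z2] [a b] /=.
have dl (c : R) : is_derive x 1 (fun x => c * x) c.
  by have := is_deriveZ c (is_derive_id x 1); rewrite [c *: 1]mulr1.
have de := is_derive1_comp (is_derive_expR (a * x)) (dl a).
have dc := is_derive1_comp (is_derive_cos (b * x)) (dl b).
have ds := is_derive1_comp (is_derive_sin (b * x)) (dl b).
have h := is_deriveB (is_deriveZ z1 (is_deriveM de dc)) (is_deriveZ z2 (is_deriveM de ds)).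
by refine (is_derive_eq h _); rewrite /GRing.scale/=; ring.
Qed.

Lemma norm_Re_cexp_le (z w : R[i]) (x : R) :
  `|complex.Re (z * cexp w x)| <=
  (`|complex.Re z| + `|complex.Im z|) * expR (complex.Re w * x).
Proof.
case: z w => [z1 z2] [a b] /=.
apply: (le_trans (ler_normB _ _)); rewrite !normrM (ger0_norm (expR_ge0 _)).
have c1 : `|cos (b * x)| <= 1 by rewrite ler_norml cos_geN1 cos_le1.
have s1 : `|sin (b * x)| <= 1 by rewrite ler_norml sin_geN1 sin_le1.
rewrite mulrDl; apply: lerD; rewrite mulrA ler_piMr// mulr_ge0 ?expR_ge0//.
Qed.

(** De Moivre's formula. *)
Lemma cexpE (t : R) (n : nat) :
  (cos t +i* sin t)%C ^+ n = (cos (n%:R * t) +i* sin (n%:R * t))%C.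
Proof.
elim: n => [|n IH]; first by rewrite expr0 mul0r cos0 sin0.
rewrite exprS IH -natr1 mulrDl mul1r cosD sinD; simpc.
by congr (_ +i* _)%C; ring.
Qed.

Lemma cos_sin_natmulpi (n : nat) : cos (n%:R * pi) = (-1) ^+ n :> R /\ sin (n%:R * pi) = 0 :> R.
Proof.
elim: n => [|n [IH1 IH2]]; first by rewrite mul0r cos0 sin0 expr0.
rewrite -natr1 mulrDl mul1r (cosD (n%:R * pi) pi) (sinD (n%:R * pi) pi) cospi sinpi IH1 IH2 exprSr.
by split; ring.
Qed.

Lemma cvg_expR_linear (a : R) : a < 0 -> expR (a * x) @[x --> +oo] --> (0 : R).
Proof.
move=> a0; have : expR (- x) @[x --> +oo] --> (0 : R) by exact: cvgr_expR.
move=> /cvgrPdist_lt h; apply/cvgrPdist_lt => e /h[M [_ hM]].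
exists (a^-1 * - M); split; first exact: num_real.
move=> x hx; have := hM (- (a * x)); rewrite opprK; apply.
by rewrite ltrNr -[ltRHS](mulVKf (ltr0_neq0 a0)) ltr_nM2l.
Qed.

Lemma sq_integrable_expR (a : R) : a < 0 -> sq_integrable `[0, +oo[ (fun x => expR (a * x)).
Proof.
move=> a0; have a2 : 2 * a != 0 by apply: mulf_neq0; [rewrite pnatr_eq0|exact: ltr0_neq0].
have dl (c x : R) : is_derive x 1 (fun x => c * x) c.
  by have := is_deriveZ c (is_derive_id x 1); rewrite [c *: 1]mulr1.
have dF (x : R) : is_derive x 1 (fun x => (2 * a)^-1 * expR (2 * a * x)) (expR (a * x) ^+ 2).
  have h := is_deriveZ (2 * a)^-1 (is_derive1_comp (is_derive_expR (2 * a * x)) (dl (2 * a) x)).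
  refine (is_derive_eq h _); rewrite [LHS]mulrCA mulVf// mulr1.
  by rewrite -expRM_natl mulrA.
have ce (c : R) : continuous (fun x : R => expR (c * x)).
  by move=> x; apply: (@continuous_comp _ _ _ ( *%R c) expR);
    [exact: mulrl_continuous|exact: continuous_expR].
split; first by apply: measurable_funTS; exact: continuous_measurable_fun.
rewrite (_ : (fun x => _) = fun x => (expR (a * x) ^+ 2)%:E); last first.
  by apply/funext => x; rewrite ger0_norm ?expR_ge0.
rewrite (@ge0_continuous_FTC2y _ _ (fun x => (2 * a)^-1 * expR (2 * a * x)) 0 0).
- by rewrite -EFinB ltry.
- by move=> x _; exact: sqr_ge0.
- by apply: continuous_subspaceT => x; apply: cvgM; exact: ce.
- rewrite -(mulr0 (2 * a)^-1); apply: cvgM; first exact: cvg_cst.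
  by apply: cvg_expR_linear; rewrite pmulr_rlt0.
- by move=> x _; have [] := dF x.
- apply: cvgM; first exact: cvg_cst.
  by apply: cvg_at_right_filter; exact: ce.
- by move=> x _; rewrite derive1E; have [_ ->] := dF x.
Qed.

Lemma is_derive_bigsum (m : nat) (h : 'I_m -> R -> R) (dh : 'I_m -> R) (x : R) :
  (forall i, is_derive x 1 (h i) (dh i)) ->
  is_derive x 1 (fun x => \sum_(i < m) h i x) (\sum_(i < m) dh i).
Proof.
move=> H; have := is_derive_sum H; congr is_derive.
by apply/funext => y; rewrite fct_sumE.
Qed.

Lemma sq_integrable_bigsum (A : set R) (m : nat) (h : 'I_m -> R -> R) : measurable A ->
  (forall i, sq_integrable A (h i)) -> sq_integrable A (fun x => \sum_(i < m) h i x).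
Proof.
move=> mA; elim: m h => [|m IH] h sh.
  apply/sq_integrableP; split.
    by under eq_fun do rewrite big_ord0; exact: measurable_cst.
  by under [X in _.-integrable _ (_ \o X)]eq_fun do rewrite big_ord0 expr0n; exact: integrable0.
under eq_fun do rewrite big_ord_recr.
by apply: sq_integrableD => //; exact: IH.
Qed.

End complex_exponential.

Section decaying_solutions.
Context {R : realType}.

(* The roots [w] of [w ^ (2 m) = (-1) ^ (m + 1)] with negative real part are the
   [i * exp (i eta_j)] with [eta_j = (2 j + 1) pi / (2 m)] in [(0, pi)]; prescribing
   the first [m] derivatives at [0] is a Vandermonde system. *)
Lemma decaying_solution (m : nat) (a : nat -> R) : (0 < m)%N ->
  exists U : nat -> R -> R, [/\
    forall k (x : R), is_derive x 1 (U k) (U k.+1 x),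
    forall k, (k < m)%N -> U k 0 = a k,
    forall x, U (m + m)%N x = (-1) ^+ m.+1 * U 0%N x &
    forall k, sq_integrable `[0, +oo[ (U k)].
Proof.
move=> m0; have m0R : 0 < m%:R :> R by rewrite ltr0n.
pose eta (j : nat) : R := pi * ((2 * j%:R + 1) / (2 * m%:R)).
pose e (j : nat) : R[i] := (cos (eta j) +i* sin (eta j))%C.
pose w (j : nat) : R[i] := ('i%C * e j).
have eta_itv (j : 'I_m) : 0 < eta j < pi.
  have h1 : 0 < (2 * j%:R + 1) / (2 * m%:R) :> R.
    by rewrite divr_gt0 ?mulr_gt0// ltr_wpDl// mulr_ge0.
  have h2 : (2 * j%:R + 1) / (2 * m%:R) < 1 :> R.
    rewrite ltr_pdivrMr ?mulr_gt0// mul1r.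
    have : j.+1%:R <= m%:R :> R by rewrite ler_nat.
    rewrite -natr1; lra.
  by rewrite /eta mulr_gt0 ?pi_gt0// gtr_pMr ?pi_gt0.
(* The real part of [i * exp (i eta)] is [- sin eta]. *)
have Rew (j : 'I_m) : complex.Re (w j) < 0.
  by rewrite /w /e; simpc => /=; rewrite oppr_lt0; exact: sin_gt0_pi.
have winj (i j : 'I_m) : w i = w j -> i = j.
  have iC0 : 'i%C != 0 :> R[i] by rewrite eq_complex/= oner_eq0 andbF.
  move=> /(mulfI iC0) [ce _].
  have /andP[i0 ipi] := eta_itv i; have /andP[j0 jpi] := eta_itv j.
  have : eta i = eta j by apply: cos_inj ce; rewrite in_itv/= !ltW.
  move=> /(mulfI (lt0r_neq0 (pi_gt0 R)))/divIf.
  have -> : 2 * m%:R != 0 :> R by rewrite mulf_neq0 ?pnatr_eq0// -lt0n.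
  move=> /(_ isT)/addIr/mulfI; rewrite pnatr_eq0 => /(_ isT)/eqP; rewrite eqr_nat => /eqP.
  exact: val_inj.
(* Here [i ^ (2 m)] contributes [(-1) ^ m], and [exp (i eta_j)] to the power [2 m] is
   [exp ((2 j + 1) pi i) = -1]. *)
have w2m (j : nat) : w j ^+ (m + m) = (-1) ^+ m.+1.
  rewrite exprMn addnn -mul2n exprM sqr_i; rewrite (cexpE (eta j)).
  have -> : (2 * m)%N%:R * eta j = j.*2.+1%:R * pi.
    rewrite /eta -natr1 -mul2n !natrM; field.
    by rewrite gt_eqF.
  have [-> ->] := cos_sin_natmulpi (R := R) j.*2.+1.
  have -> : (-1) ^+ j.*2.+1 = -1 :> R by rewrite -signr_odd/= odd_double expr1.
  have -> : (-1 +i* 0)%C = -1 :> R[i] by apply/eqP; rewrite eq_complex/= oppr0 !eqxx.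
  by rewrite mulrC -exprS.
pose V := Vandermonde m (\row_(j < m) w j).
have Vu : V \in unitmx.
  rewrite unitmxE unitfE det_Vandermonde; apply/prodf_neq0 => i _.
  apply/prodf_neq0 => j ij; rewrite !mxE subr_eq0; apply: contraTneq ij => /winj ->.
  by rewrite ltnn.
pose c := invmx V *m (\col_(k < m) (a k)%:C%C).
have Vc (k : 'I_m) : \sum_(j < m) c j 0 * w j ^+ k = (a k)%:C%C.
  have := congr1 (fun M : 'cV[R[i]]_m => M k 0) (mulKVmx Vu (\col_(k < m) (a k)%:C%C)).
  rewrite [RHS]mxE => <-; rewrite -/c [RHS]mxE.
  by apply: eq_bigr => j _; rewrite !mxE mulrC.
(* Taking real parts keeps the equation, whose coefficient is real, and the initial values, since
   the [a k] are real. *)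
pose U k x := \sum_(j < m) complex.Re (c j 0 * w j ^+ k * cexp (w j) x).
exists U; split.
- move=> k x; rewrite /U.
  have := is_derive_bigsum (fun j => is_derive_Re_cexp (c j 0 * w j ^+ k) (w j) x).
  by under [X in is_derive _ _ _ X]eq_bigr do rewrite -(mulrA (c _ 0)) -exprSr.
- move=> k km; have := congr1 (@complex.Re R) (Vc (Ordinal km)) => /= <-.
  rewrite (big_morph (@complex.Re R) (id1 := 0) (op1 := +%R)) => [|[x1 x2] [y1 y2]|]//.
  apply: eq_bigr => j _; congr complex.Re; rewrite -[RHS]mulr1; congr (_ * _).
  by rewrite /cexp !mulr0 expR0 cos0 sin0 mulr1 mulr0.
- move=> x; rewrite mulr_sumr; apply: eq_bigr => j _.
  rewrite w2m expr0 mulr1 -(signr_odd _ m.+1) -(signr_odd R m.+1).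
  case: (odd m.+1); last by rewrite !expr0 mulr1 mul1r.
  by rewrite !expr1 mulrN1 mulN1r mulNr; case: (_ * _).
- move=> k; apply: sq_integrable_bigsum => [|j]; first exact: measurable_itv.
  set C := (`|complex.Re (c j 0 * w j ^+ k)| + `|complex.Im (c j 0 * w j ^+ k)|).
  have se := sq_integrable_expR (Rew j); have [_ se2] := (sq_integrableP _ _).1 se.
  apply: (@sq_integrable_le _ `[0, +oo[%classic (measurable_itv _) _
    (fun x => C ^+ 2 * expR (complex.Re (w j) * x) ^+ 2)).
  + apply: measurable_funTS; apply: continuous_measurable_fun => x.
    apply: differentiable_continuous; apply/derivable1_diffP.
    by have [] := is_derive_Re_cexp (c j 0 * w j ^+ k) (w j) x.
  + move=> x _; rewrite -exprMn -[leLHS]real_normK ?num_real//.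
    rewrite ler_pXn2r ?nnegrE ?mulr_ge0 ?addr_ge0 ?expR_ge0//.
    exact: norm_Re_cexp_le.
  + by apply: integrable_EFinZ => //; exact: measurable_itv.
Qed.

End decaying_solutions.

(** * Continuous functions and continuous derivatives *)

Section continuous_derivative.
Context {R : realType}.
Notation mu := (@lebesgue_measure R).

Lemma is_derive_continuous (F : R -> R) (dF : R -> R) :
  (forall x : R, is_derive x 1 F (dF x)) -> continuous F.
Proof.
move=> hF x; apply: differentiable_continuous; apply/derivable1_diffP.
by have [] := hF x.
Qed.

Lemma C1_riesz (p q : R) (F dF : R -> R) :
  (forall x : R, is_derive x 1 F (dF x)) -> continuous dF -> riesz p q F.
Proof.
move=> hF cdF; have [pq|qp] := leP p q; last first.
  apply: (@riesz_lipschitz _ _ _ _ 0) => x y px xy yq.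
  by have := le_lt_trans (le_trans px (le_trans xy yq)) qp; rewrite ltxx.
have cn : {within `[p, q], continuous (fun x => `|dF x|)}.
  by apply: continuous_subspaceT => x; apply: cvg_norm; exact: cdF.
have [c _ hc] := EVT_max pq cn.
apply: (@riesz_lipschitz _ _ _ _ `|dF c|) => x y px xy yq.
have [|z] := @MVT_segment R F dF x y xy (fun z _ => hF z).
  by apply: continuous_subspaceT; exact: is_derive_continuous hF.
rewrite in_itv/= => /andP[xz zy] ->; rewrite normrM [`|y - x|]ger0_norm ?subr_ge0//.
apply: ler_wpM2r; first by rewrite subr_ge0.
by apply: hc; rewrite in_itv/= (le_trans px xz) (le_trans zy yq).
Qed.

Lemma riesz_continuous (F : R -> R) : (forall p q, p < q -> riesz p q F) -> continuous F.
Proof.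
move=> rF x; apply/cvgrPdist_lt => e e0.
have xx : x - 1 < x + 1 by lra.
have [d d0 dF] := ac_families_within_continuous (riesz_ac (rF _ _ xx)) e0.
apply/nbhs_ballP; exists (Num.min d 1); first by rewrite /= lt_min d0 ltr01.
move=> y; rewrite /ball/= lt_min => /andP[yd y1].
move: (y1); rewrite ltr_norml => /andP[h1 h2].
have [xy|/ltW yx] := leP x y.
  rewrite distrC; apply: dF; rewrite ?gerBl//; [lra|].
  by rewrite -[_ - _]ger0_norm ?subr_ge0// distrC.
by apply: dF; [lra|done|lra|rewrite -[_ - _]ger0_norm ?subr_ge0].
Qed.

Lemma sq_integrable_continuous (p q : R) (F : R -> R) : continuous F ->
  sq_integrable `[p, q] F.
Proof.
move=> cF; apply/sq_integrableP; split.
  by apply: measurable_funTS; exact: continuous_measurable_fun.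
apply: continuous_compact_integrable; first exact: segment_compact.
by apply: continuous_subspaceT => x; apply: cvgM; exact: cF.
Qed.

Lemma is_derive_affine (F : R -> R) (s c x l : R) :
  is_derive (s * x + c) 1 F l -> is_derive x 1 (fun x => F (s * x + c)) (s * l).
Proof.
move=> dF; have ds : is_derive x 1 (fun x => s * x + c) s.
  have := is_deriveD (is_deriveZ s (is_derive_id x 1)) (is_derive_cst c x 1).
  by rewrite addr0 [s *: 1]mulr1.
by have := @is_derive1_comp R F (fun x => s * x + c) x l s dF ds; rewrite mulrC.
Qed.

End continuous_derivative.

(** * Glueing the tails to the prescribed values *)

Section glueing.
Context {R : realType}.
Notation mu := (@lebesgue_measure R).
Variables (m : nat) (a b : R) (L d U : nat -> R -> R).
Hypothesis ab : a < b.
Hypothesis dL : forall k (x : R), is_derive x 1 (L k) (L k.+1 x).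
Hypothesis dU : forall k (x : R), is_derive x 1 (U k) (U k.+1 x).
Hypothesis dd : forall k, (k < m)%N -> forall x, a <= x -> x <= b ->
  has_deriv_in `[a, b] (d k) x (d k.+1 x).
Hypothesis rd : forall k, (k <= m)%N -> riesz a b (d k).
Hypothesis La : forall k, (k <= m)%N -> L k a = d k a.
Hypothesis Ub : forall k, (k <= m)%N -> U k b = d k b.
Hypothesis L2 : forall k, sq_integrable `]-oo, a] (L k).
Hypothesis U2 : forall k, sq_integrable `[b, +oo[ (U k).

(** All orders are glued at once. The target is H^(m+1)(R): for [k <= m] the pieces agree at [a] and
    [b], so that either formula may be used there. *)
Definition glue k x := if x < a then L k x else if x <= b then d k x else U k x.

Let glueL k x : (k <= m)%N -> x <= a -> glue k x = L k x.
Proof.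
move=> km; rewrite le_eqVlt => /predU1P[->|xa]; last by rewrite /glue xa.
by rewrite /glue ltxx (ltW ab) La.
Qed.

Let glueI k x : a <= x -> x <= b -> glue k x = d k x.
Proof. by move=> ax xb; rewrite /glue ltNge ax xb. Qed.

Let glueU k x : (k <= m)%N -> b <= x -> glue k x = U k x.
Proof.
move=> km; rewrite le_eqVlt => /predU1P[<-|bx].
  by rewrite /glue ltNge (ltW ab) lexx/= Ub.
by rewrite /glue ltNge (le_trans (ltW ab) (ltW bx))/= leNgt bx.
Qed.

Let hdL k x : (k <= m)%N -> x <= a -> has_deriv_in `]-oo, a] (glue k) x (L k.+1 x).
Proof.
move=> km xa; apply: eq_has_deriv_in (is_derive_has_deriv_in `]-oo, a]%classic (dL k x)).
  by rewrite glueL.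
by move=> y; rewrite /= in_itv/= => ya; rewrite glueL.
Qed.

Let hdU k x : (k <= m)%N -> b <= x -> has_deriv_in `[b, +oo[ (glue k) x (U k.+1 x).
Proof.
move=> km bx; apply: eq_has_deriv_in (is_derive_has_deriv_in `[b, +oo[%classic (dU k x)).
  by rewrite glueU.
by move=> y; rewrite /= in_itv/= andbT => yb; rewrite glueU.
Qed.

Let hdI k x : (k < m)%N -> a <= x -> x <= b -> has_deriv_in `[a, b] (glue k) x (d k.+1 x).
Proof.
move=> km ax xb; apply: eq_has_deriv_in (dd km ax xb).
  by rewrite glueI.
by move=> y; rewrite /= in_itv/= => /andP[ay yb]; rewrite glueI.
Qed.

Lemma is_derive_glueL k (x : R) : (k <= m)%N -> x < a -> is_derive x 1 (glue k) (L k.+1 x).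
Proof.
move=> km xa; apply: has_deriv_in_is_derive (hdL km (ltW xa)).
by apply: (@filterS _ _ _ `]-oo, a[%classic);
  [apply: subset_itvl; rewrite bnd_simp|exact: near_in_itvNyo].
Qed.

Lemma is_derive_glueU k (x : R) : (k <= m)%N -> b < x -> is_derive x 1 (glue k) (U k.+1 x).
Proof.
move=> km bx; apply: has_deriv_in_is_derive (hdU km (ltW bx)).
by apply: (@filterS _ _ _ `]b, +oo[%classic);
  [apply: subset_itvr; rewrite bnd_simp|apply: near_in_itvoy; rewrite in_itv/= bx].
Qed.

(** At [a] and [b] the one-sided derivatives agree because the pieces still match at order
    [k.+1 <= m]. *)
Lemma is_derive_glue k (x : R) : (k < m)%N -> is_derive x 1 (glue k) (glue k.+1 x).
Proof.
move=> km; have km' := ltnW km; have ba0 : 0 < b - a by rewrite subr_gt0.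
have [xa|] := ltP x a; first by rewrite glueL ?(ltW xa)//; exact: is_derive_glueL.
have [xb _|] := ltP b x; first by rewrite glueU ?(ltW xb)//; exact: is_derive_glueU.
move=> xb ax; apply: (@has_deriv_in_is_derive _ setT); first exact: filterT.
rewrite glueI//; move: xb; rewrite le_eqVlt => /predU1P[xb|xb].
  subst x; have h1 := hdI km ax (lexx b).
  have h2 := hdU km' (lexx b); rewrite Ub// in h2.
  apply: has_deriv_inW ba0 _ (has_deriv_inU h1 h2) => y _.
  rewrite ltr_norml => /andP[h _].
  have [yb|/ltW yb] := leP y b; [left|right]; rewrite /= in_itv/= ?yb ?andbT//.
  lra.
move: ax; rewrite le_eqVlt => /predU1P[xa|ax].
  subst x; have h1 := hdI km (lexx a) (ltW ab).
  have h2 := hdL km' (lexx a); rewrite La// in h2.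
  apply: has_deriv_inW ba0 _ (has_deriv_inU h2 h1) => y _.
  rewrite ltr_norml => /andP[_ h].
  have [ya|/ltW ya] := leP y a; [left|right]; rewrite /= in_itv/= ?ya ?andbT//=.
  lra.
have e0 : 0 < Num.min (x - a) (b - x) by rewrite lt_min !subr_gt0 ax.
apply: has_deriv_inW e0 _ (hdI km (ltW ax) (ltW xb)) => y _.
rewrite lt_min => /andP[h1 h2]; rewrite /= in_itv/=.
by move: h1 h2; rewrite !ltr_norml => /andP[h1 h2] /andP[h3 h4]; apply/andP; split; lra.
Qed.

Lemma derive1n_glue k : (k <= m)%N -> derive1n k (glue 0) = glue k.
Proof.
elim: k => [//|k IH km]; rewrite derive1nS IH ?(ltnW km)//.
apply/funext => x; rewrite derive1E; have := is_derive_glue x km.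
by move=> -[_ ->].
Qed.

Lemma riesz_glue_segment k p q : (k <= m)%N -> riesz p q (glue k).
Proof.
(* The segment is enlarged so that both glueing points lie in it, whatever the position of
   [[p, q]]. *)
move=> km; pose p' := Num.min p a; pose q' := Num.max q b.
have p'p : p' <= p by rewrite ge_min lexx.
have p'a : p' <= a by rewrite ge_min lexx orbT.
have qq' : q <= q' by rewrite le_max lexx.
have bq' : b <= q' by rewrite le_max lexx orbT.
apply: rieszS p'p qq' _; apply: (@riesz_glue _ _ b) => //; first exact: le_trans (ltW ab).
  apply: (@riesz_glue _ _ a) => //; first exact: ltW.
    apply: (@eq_riesz _ _ _ (L k)) => [x _ xa|]; first by rewrite glueL.
    by apply: C1_riesz (dL k) _; exact: is_derive_continuous (dL k.+1).
  by apply: eq_riesz (rd km) => x ax xb; rewrite glueI.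
apply: (@eq_riesz _ _ _ (U k)) => [x bx _|]; first by rewrite glueU.
by apply: C1_riesz (dU k) _; exact: is_derive_continuous (dU k.+1).
Qed.

(** Order [m.+1] is included, one more than in [derive1n_glue]: on the open half-line the glued
    function is smooth. *)
Lemma derive1n_glue_left k (x : R) : (k <= m.+1)%N -> x < a -> derive1n k (glue 0) x = L k x.
Proof.
rewrite leq_eqVlt => /predU1P[->|km] xa; last by rewrite derive1n_glue// glueL// ltW.
rewrite derive1nS derive1n_glue// derive1E.
by have [_ ->] := is_derive_glueL (leqnn m) xa.
Qed.

Lemma derive1n_glue_right k (x : R) : (k <= m.+1)%N -> b < x -> derive1n k (glue 0) x = U k x.
Proof.
rewrite leq_eqVlt => /predU1P[->|km] bx; last by rewrite derive1n_glue// glueU// ltW.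
rewrite derive1nS derive1n_glue// derive1E.
by have [_ ->] := is_derive_glueU (leqnn m) bx.
Qed.

Lemma glue_sobolevR : sobolevR R m.+1 (glue 0).
Proof.
have cG k : (k <= m)%N -> continuous (glue k).
  by move=> km; apply: riesz_continuous => p q _; exact: riesz_glue_segment.
split.
- move=> k km x; rewrite derive1n_glue; last exact: ltnW.
  by have [] := is_derive_glue x km.
- move=> p q pq; rewrite /= derive1n_glue//; apply/abs_continuousP.
  by apply: riesz_ac; exact: riesz_glue_segment.
move=> k km.
have mG : measurable_fun setT (derive1n k (glue 0)).
  move: km; rewrite leq_eqVlt => /predU1P[->|km].
    by rewrite derive1nS derive1n_glue//; apply: measurable_derive1; exact: cG.
  by rewrite derive1n_glue//; apply: continuous_measurable_fun; exact: cG.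
have mI (i : interval R) : measurable [set` i] by exact: measurable_itv.
have -> : setT = `]-oo, a[%classic `|` `[a, b]%classic `|` `]b, +oo[%classic.
  apply/seteqP; split => // x _; rewrite /= !in_itv/=.
  have [xa|ax] := ltP x a; first by left; left.
  by have [xb|bx] := leP x b; [left; right|right].
apply: sq_integrableU => //; first exact: measurableU.
  apply: sq_integrableU => //.
    apply: (@eq_sq_integrable _ _ (L k)).
      by move=> x; rewrite inE/= in_itv/= => xa; rewrite derive1n_glue_left.
    by apply: sq_integrableS (L2 k) => //; apply: subset_itvl; rewrite bnd_simp.
  (* On [[a, b]], square integrability comes from the Riesz class at order [m.+1] and from
     continuity at lower orders. *)
  move: km; rewrite leq_eqVlt => /predU1P[->|km]; last first.
    by rewrite derive1n_glue//; apply: sq_integrable_continuous; exact: cG.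
  rewrite derive1nS derive1n_glue//; apply: riesz_sq_integrable => //.
    exact: riesz_glue_segment.
  by apply: measurable_funTS; apply: measurable_derive1; exact: cG.
apply: (@eq_sq_integrable _ _ (U k)).
  by move=> x; rewrite inE/= in_itv/= andbT => bx; rewrite derive1n_glue_right.
by apply: sq_integrableS (U2 k) => //; apply: subset_itvr; rewrite bnd_simp.
Qed.

End glueing.

(** * Integrals over half-lines without boundary term at infinity *)

Section vanishing_integral.
Context {R : realType}.
Notation mu := (@lebesgue_measure R).

Lemma Rintegral_setID (A B : set R) (h : R -> R) :
  measurable A -> measurable B -> mu.-integrable A (EFin \o h) ->
  \int[mu]_(x in A) h x = \int[mu]_(x in A `&` B) h x + \int[mu]_(x in A `\` B) h x.
Proof.
move=> mA mB inth; rewrite -[in LHS](setUIDK A B) Rintegral_setU.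
- by [].
- exact: (measurableI _ _ mA mB).
- exact: (measurableD mA mB).
- by rewrite setUIDK.
- by apply/disj_setPS => x [[_ ?] []].
Qed.

(** By monotone convergence, the integrals of [|h|] over [A] cut to [[-n, n]] increase to the whole
    integral. *)
Lemma integrable_tail (A : set R) (h : R -> R) (e : R) : measurable A -> 0 < e ->
  mu.-integrable A (EFin \o h) ->
  exists n0 : nat, forall n, (n0 <= n)%N ->
    \int[mu]_(x in A `\` `[- n%:R, n%:R]) `|h x| < e.
Proof.
move=> mA e0 inth; pose I n := `[- n%:R, n%:R]%classic : set R.
have mI n : measurable (I n) by exact: measurable_itv.
have mF n : measurable (A `&` I n) by exact: measurableI.
have mD n : measurable (A `\` I n) by exact: measurableD.
have mh := measurable_integrable inth.
have intn : mu.-integrable A (EFin \o (fun x => `|h x|)) by exact: integrable_norm inth.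
have ndF : nondecreasing_seq (fun n => A `&` I n).
  move=> k l kl; apply/subsetPset; apply: setIS => x; rewrite /I/= !in_itv/= => /andP[h1 h2].
  have kl' : k%:R <= l%:R :> R by rewrite ler_nat.
  by apply/andP; split; lra.
have UF : \bigcup_n (A `&` I n) = A.
  apply/seteqP; split => [x [n _ []]//|x Ax]; exists (Num.bound `|x|) => //; split => //.
  have := archi_boundP (normr_ge0 x); rewrite ltr_norml => /andP[h1 h2].
  by rewrite /I/= in_itv/= !ltW.
have intF n : mu.-integrable (A `&` I n) (EFin \o (fun x => `|h x|)).
  by apply: integrable_EFinS intn => //; exact: subIsetl.
have intD n : mu.-integrable (A `\` I n) (EFin \o (fun x => `|h x|)).
  by apply: integrable_EFinS intn => //; exact: subDsetl.
have AE n : \int[mu]_(x in A) `|h x| =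
    \int[mu]_(x in A `&` I n) `|h x| + \int[mu]_(x in A `\` I n) `|h x|.
  by apply: Rintegral_setID.
have cvgF : \int[mu]_(x in A `&` I n) `|h x| @[n --> \oo] --> \int[mu]_(x in A) `|h x|.
  apply: fine_cvg; rewrite fineK; last by apply: integrable_fin_num => //; exact: intn.
  rewrite -{2}UF; apply: ge0_nondecreasing_set_cvg_integral => //.
  - by move=> n; apply/measurable_EFinP; exact: measurable_integrable (intF n).
move/cvgrPdist_lt : cvgF => /(_ _ e0)[n0 _ hn0]; exists n0 => n /hn0 /=.
rewrite (AE n) addrAC subrr add0r ger0_norm//.
by apply: Rintegral_ge0.
Qed.

(* [B] tends to the integral of [h] at infinity, and an integrable function cannot
   have a nonzero limit there. *)
Lemma vanishing_integral (A : set R) (h B : R -> R) (S : R -> set R) (n0 : nat) :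
  measurable A -> (forall n : nat, mu (A `\` `[- n%:R, n%:R]) = +oo%E) ->
  mu.-integrable A (EFin \o h) -> mu.-integrable A (EFin \o B) ->
  (forall x, A x -> [/\ measurable (S x), S x `<=` A & \int[mu]_(t in S x) h t = B x]) ->
  (forall x (n : nat), A x -> (n0 <= n)%N -> ~ `[- n%:R, n%:R]%classic x ->
     A `\` S x `<=` A `\` `[- n%:R, n%:R]%classic) ->
  \int[mu]_(t in A) h t = 0.
Proof.
move=> mA infA inth intB SB farS; apply/eqP; apply: contrapT => /negP I0.
set I := \int[mu]_(t in A) h t in I0.
have e0 : 0 < `|I| / 2 by rewrite divr_gt0 ?normr_gt0.
have [n1 hn1] := integrable_tail mA e0 inth.
pose n := maxn n0 n1; have := hn1 n (leq_maxr _ _) => tail.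
pose A' := A `\` `[- n%:R, n%:R]%classic.
have mA' : measurable A' by apply: measurableD => //; exact: measurable_itv.
(* [B x] differs from [I] by an integral over a part of the tail; hence [B] stays away from [0] on
   [A'], a set of infinite measure. *)
have Blow x : A' x -> `|I| / 2 <= `|B x|.
  move=> [Ax nx]; have [mS SA <-] := SB x Ax.
  have mAS : measurable (A `\` S x) by exact: measurableD.
  have IE : I = \int[mu]_(t in S x) h t + \int[mu]_(t in A `\` S x) h t.
    by rewrite /I (Rintegral_setID mA mS inth) (setIidr SA).
  have : `|\int[mu]_(t in A `\` S x) h t| < `|I| / 2.
    apply: le_lt_trans tail.
    have intAS : mu.-integrable (A `\` S x) (EFin \o h).
      by apply: integrable_EFinS inth => //; exact: subDsetl.
    apply: (@le_trans _ _ (\int[mu]_(t in A `\` S x) `|h t|)).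
      by apply: le_normr_Rintegral => //; exact: mAS.
    rewrite /Rintegral; apply: fine_le.
    - apply: integrable_fin_num => //; apply: integrable_norm.
      by apply: integrable_EFinS inth => //; exact: subDsetl.
    - apply: integrable_fin_num => //; apply: integrable_norm.
      by apply: integrable_EFinS inth => //; exact: subDsetl.
    - apply: ge0_subset_integral => //.
      + apply/measurable_EFinP; apply: measurableT_comp => //.
        by apply: measurable_funS (measurable_integrable inth) => //; exact: subDsetl.
      + by apply: farS => //; exact: leq_maxl.
  move=> h1; have : `|I| <= `|\int[mu]_(t in S x) h t| + `|\int[mu]_(t in A `\` S x) h t|.
    by rewrite {1}IE; exact: ler_normD.
  lra.
have inB0 : mu.-integrable A (EFin \o (fun x => `|B x|)) by exact: integrable_norm intB.
have inB : mu.-integrable A' (EFin \o (fun x => `|B x|)).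
  by apply: integrable_EFinS inB0 => //; exact: subDsetl.
have : (\int[mu]_(x in A) (`|B x|)%:E < +oo)%E.
  by have /integrableP[_] := intB.
apply/negP; rewrite -leNgt leye_eq.
have : (+oo <= \int[mu]_(x in A') (`|I| / 2)%:E)%E.
  rewrite integral_cst; last exact: mA'.
  apply: (@le_trans _ _ ((`|I| / 2)%:E * +oo)%E).
    by rewrite gt0_muley ?lte_fin.
  by apply: lee_wpmul2l; [rewrite lee_fin ltW|rewrite -(infA n)].
move=> h1; rewrite -leye_eq; apply: (le_trans h1).
apply: (@le_trans _ _ (\int[mu]_(x in A') (`|B x|)%:E)%E).
  apply: ge0_le_integral => //.
  exact (measurable_int mu inB).
apply: ge0_subset_integral => //; last exact: subDsetl.
exact (measurable_int mu inB0).
Qed.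

Lemma vanishing_integral_right (b : R) (h B : R -> R) :
  mu.-integrable `[b, +oo[ (EFin \o h) -> mu.-integrable `[b, +oo[ (EFin \o B) ->
  (forall x, b <= x -> \int[mu]_(t in `[b, x]) h t = B x) ->
  \int[mu]_(t in `[b, +oo[) h t = 0.
Proof.
move=> inth intB hB.
have mI (i : interval R) : measurable [set` i] by exact: measurable_itv.
(* Once [n] exceeds [|b|], a point of the half-line outside [[-n, n]] lies to the right of [n]. *)
apply: (@vanishing_integral _ h B (fun x => `[b, x]%classic) (Num.bound `|b|)) => //.
- move=> n; apply/eqP; rewrite -leye_eq.
  pose c := Num.max b (n%:R + 1).
  have -> : (+oo = mu `[c, +oo[%classic)%E.
    by rewrite lebesgue_measure_itv/= ltry.
  apply: le_measure; rewrite ?inE; [exact: mI|apply: measurableD; exact: mI|].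
  move=> x; rewrite /= !in_itv/= !andbT ge_max => /andP[bx nx]; split => //.
  by apply/negP; rewrite negb_and -!ltNge; apply/orP; right; lra.
- move=> x; rewrite /= in_itv/= andbT => bx; split; [exact: mI| |exact: hB].
  by apply: subset_itvl; rewrite bnd_simp.
- move=> x n; rewrite /= in_itv/= andbT => bx nb nx y [/=]; rewrite !in_itv/= andbT.
  move=> by_ nyx; split => //.
  have nbR : (Num.bound `|b|)%:R <= n%:R :> R by rewrite ler_nat.
  have := archi_boundP (normr_ge0 b); rewrite ltr_norml => /andP[bn _].
  have nx' : n%:R < x.
    by rewrite ltNge; apply/negP => xn; apply: nx; rewrite in_itv/= xn andbT; lra.
  have xy : x < y.
    by rewrite ltNge; apply/negP => yx; apply: nyx; rewrite by_ yx.
  by apply/negP; rewrite negb_and -!ltNge; apply/orP; right; lra.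
Qed.

Lemma vanishing_integral_left (a : R) (h B : R -> R) :
  mu.-integrable `]-oo, a] (EFin \o h) -> mu.-integrable `]-oo, a] (EFin \o B) ->
  (forall x, x <= a -> \int[mu]_(t in `[x, a]) h t = B x) ->
  \int[mu]_(t in `]-oo, a]) h t = 0.
Proof.
move=> inth intB hB.
have mI (i : interval R) : measurable [set` i] by exact: measurable_itv.
apply: (@vanishing_integral _ h B (fun x => `[x, a]%classic) (Num.bound `|a|)) => //.
- move=> n; apply/eqP; rewrite -leye_eq.
  pose c := Num.min a (- n%:R - 1).
  have -> : (+oo = mu `]-oo, c]%classic)%E.
    by rewrite lebesgue_measure_itv/= ltNyr.
  apply: le_measure; rewrite ?inE; [exact: mI|apply: measurableD; exact: mI|].
  move=> x; rewrite /= !in_itv/= le_min => /andP[xa xn]; split => //.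
  by apply/negP; rewrite negb_and -!ltNge; apply/orP; left; lra.
- move=> x; rewrite /= in_itv/= => xa; split; [exact: mI| |exact: hB].
  by apply: subset_itvr; rewrite bnd_simp.
- move=> x n; rewrite /= in_itv/= => xa nb nx y [/=]; rewrite !in_itv/=.
  move=> ya nxy; split => //.
  have nbR : (Num.bound `|a|)%:R <= n%:R :> R by rewrite ler_nat.
  have := archi_boundP (normr_ge0 a); rewrite ltr_norml => /andP[_ an].
  have nx' : x < - n%:R.
    by rewrite ltNge; apply/negP => xn; apply: nx; rewrite in_itv/= xn/=; lra.
  have xy : y < x.
    by rewrite ltNge; apply/negP => yx; apply: nxy; rewrite ya yx.
  by apply/negP; rewrite negb_and -!ltNge; apply/orP; left; lra.
Qed.

End vanishing_integral.

(** * Jets on the line and Green's formula *)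

Section sobolev_jets.
Context {R : realType}.
Notation mu := (@lebesgue_measure R).
Implicit Types (n : nat) (z U : nat -> R -> R).

(** The derivatives are kept as data: where the top derivative fails to exist, [derive1n] of a
    difference need not be the difference of the [derive1n], whereas jets can be subtracted
    termwise. *)
Definition sobolev_jet n z : Prop :=
  [/\ forall k, (k < n)%N -> forall x : R, is_derive x 1 (z k) (z k.+1 x),
      forall p q : R, p < q -> riesz p q (z n),
      forall p q : R, p < q ->
        {ae mu, forall x, x \in `]p, q[ -> is_derive x 1 (z n) (z n.+1 x)} &
      forall k, (k <= n.+1)%N -> sq_integrable setT (z k)].

Lemma sobolevR_jet n (w : R -> R) : sobolevR R n.+1 w ->
  sobolev_jet n (fun k => derive1n k w).
Proof.
move=> [/= dw acw w2]; split.
- by move=> k kn x; rewrite derive1nS derive1E; apply/derivableP; exact: dw.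
- move=> p q pq; apply: (riesz_of_derivative pq (G := derive1n n.+1 w)).
  + exact/abs_continuousP/acw.
  + by apply: sq_integrableS (w2 _ (leqnn _)) => //; exact: measurable_itv.
  + by move=> x l _ [_ <-]; rewrite derive1nS derive1E.
- move=> p q pq.
  have := ac_families_ae_derive pq ((abs_continuousP _ _ _).1 (acw _ _ pq)).
  by apply: aeS => x h /h ?; rewrite derive1nS derive1E; exact/derivableP.
- exact: w2.
Qed.

Lemma sobolev_jetB n z1 z2 : sobolev_jet n z1 -> sobolev_jet n z2 ->
  sobolev_jet n (fun k x => z1 k x - z2 k x).
Proof.
move=> [d1 r1 a1 s1] [d2 r2 a2 s2]; split.
- by move=> k kn x; apply: is_deriveB; [exact: d1|exact: d2].
- move=> p q pq; apply: rieszD; first exact: r1.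
  suff : riesz p q (fun x => (-1) * z2 n x) by apply: eq_riesz => x _ _; rewrite mulN1r.
  by apply: rieszM; [exact: riesz_cst|exact: r2].
- move=> p q pq; apply: aeS2 (a1 _ _ pq) (a2 _ _ pq) => x h1 h2 xpq.
  by apply: is_deriveB; [exact: h1|exact: h2].
- by move=> k kn; apply: sq_integrableB; [|exact: s1|exact: s2].
Qed.

Lemma sobolev_jet_continuous n z k : sobolev_jet n z -> (k <= n)%N -> continuous (z k).
Proof.
move=> [dz rz _ _]; rewrite leq_eqVlt => /predU1P[->|kn].
  exact: riesz_continuous.
by apply: is_derive_continuous => x; exact: dz.
Qed.

Lemma sobolev_jet_riesz n z k (p q : R) : sobolev_jet n z -> (k <= n)%N -> p < q ->
  riesz p q (z k).
Proof.
move=> jz; have [dz rz _ _] := jz; rewrite leq_eqVlt => /predU1P[->|kn] pq.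
  exact: rz.
by apply: C1_riesz (fun x => dz _ kn x) _; exact: sobolev_jet_continuous jz _.
Qed.

Lemma riesz_bigsum n (p q : R) (F : nat -> R -> R) :
  (forall k, (k < n)%N -> riesz p q (F k)) ->
  riesz p q (fun x => \sum_(k < n) F k x).
Proof.
elim: n => [|n IH] rF.
  by under eq_fun do rewrite big_ord0; exact: riesz_cst.
under eq_fun do rewrite big_ord_recr/=; apply: rieszD; last exact: rF.
by apply: IH => k kn; apply: rF; rewrite ltnS ltnW.
Qed.

Lemma integrable_bigsum n (A : set R) (F : nat -> R -> R) : measurable A ->
  (forall k, (k < n)%N -> mu.-integrable A (EFin \o F k)) ->
  mu.-integrable A (EFin \o (fun x => \sum_(k < n) F k x)).
Proof.
move=> mA; elim: n => [|n IH] rF.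
  by under [X in _ \o X]eq_fun do rewrite big_ord0; exact: integrable0.
under [X in _ \o X]eq_fun do rewrite big_ord_recr/=.
apply: integrable_EFinD => //; last exact: rF.
by apply: IH => k kn; apply: rF; rewrite ltnS ltnW.
Qed.

(** These are the boundary terms produced by moving the [n.+1] derivatives of [z] onto [U] one at a
    time. *)
Definition green_boundary n U z (x : R) : R :=
  \sum_(j < n.+1) (-1) ^+ j * (U (n.+1 + j)%N x * z (n - j)%N x).

(** In place of repeated integrations by parts, the fundamental theorem is applied once to
    [green_boundary], whose derivative telescopes to the integrand. The equation for [U] turns the
    last term, of order [2 n + 2] in [U], into [U z]. *)
Lemma green n z U (p q : R) : p < q -> sobolev_jet n z ->
  (forall k (x : R), is_derive x 1 (U k) (U k.+1 x)) ->
  (forall x, U (n.+1 + n.+1)%N x = (-1) ^+ n.+2 * U 0%N x) ->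
  \int[mu]_(x in `[p, q]) (U 0%N x * z 0%N x + U n.+1 x * z n.+1 x) =
  green_boundary n U z q - green_boundary n U z p.
Proof.
move=> pq jz dU U2m; have [dz rz az sz] := jz.
have cU k : continuous (U k) by apply: is_derive_continuous (dU k).
pose G x := U 0%N x * z 0%N x + U n.+1 x * z n.+1 x.
have telescope x : \sum_(j < n.+1) (-1) ^+ j *
    (U (n.+1 + j)%N x * z (n - j).+1 x + z (n - j)%N x * U (n.+1 + j).+1 x) = G x.
  pose T j := (-1) ^+ j * (U (n.+1 + j)%N x * z (n.+1 - j)%N x).
  transitivity (\sum_(j < n.+1) (T j - T j.+1)).
    apply: eq_bigr => -[j /= jn] _; rewrite /T subSS addnS subSn -1?ltnS// exprS; ring.
  rewrite -(big_mkord xpredT (fun j => T j - T j.+1)).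
  under eq_bigr do rewrite -opprB.
  rewrite sumrN telescope_sumr// opprB /T subnn subn0 addn0 expr0 mul1r U2m /G !exprS.
  have := sqrr_sign R n; set e := (-1) ^+ n => e1.
  by rewrite !mulN1r opprK mulNr opprK !mulrA -expr2 e1 mul1r addrC.
have acB : ac_families p q (green_boundary n U z).
  apply: riesz_ac; apply: (@riesz_bigsum _ _ _
    (fun j x => (-1) ^+ j * (U (n.+1 + j)%N x * z (n - j)%N x))) => j jn.
  apply: rieszM; first exact: riesz_cst.
  apply: rieszM; first by apply: C1_riesz (dU _) _; exact: cU.
  by apply: sobolev_jet_riesz jz _ pq; exact: leq_subr.
have mpq : measurable `[p, q]%classic by exact: measurable_itv.
have sq k : (k <= n.+1)%N -> sq_integrable `[p, q] (z k).
  by move=> kn; apply: sq_integrableS (sz _ kn).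
have iG : mu.-integrable `[p, q] (EFin \o G).
  apply: integrable_EFinD => //.
    by apply: sq_integrableM; [|exact: sq_integrable_continuous|exact: sq].
  by apply: sq_integrableM; [|exact: sq_integrable_continuous|exact: sq].
have [|intG ->//] := ac_families_FTC pq acB (measurable_integrable iG); last by rewrite ltW.
apply: aeS (az _ _ pq) => x h /h dzn l dB.
suff : is_derive x 1 (green_boundary n U z) (G x) by move=> [_ <-]; case: dB.
rewrite -telescope; apply: is_derive_bigsum => -[j /= jn].
have dzj : is_derive x 1 (z (n - j)%N) (z (n - j).+1 x).
  have [->|j0] := posnP j; first by rewrite subn0.
  by apply: dz; rewrite ltn_subrL j0 (leq_trans j0).
apply: is_deriveZ; apply: is_deriveM.
Qed.

Lemma green_boundary_integrable n U z (A : set R) : measurable A ->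
  (forall k, sq_integrable A (U k)) -> (forall k, (k <= n.+1)%N -> sq_integrable A (z k)) ->
  mu.-integrable A (EFin \o green_boundary n U z).
Proof.
move=> mA sU sz; apply: (@integrable_bigsum _ _
  (fun j x => (-1) ^+ j * (U (n.+1 + j)%N x * z (n - j)%N x))) => // j jn.
apply: integrable_EFinZ => //; apply: sq_integrableM => //.
by apply: sz; rewrite (leq_trans (leq_subr _ _)).
Qed.

Lemma green_boundary0 n U z (x : R) : (forall k, (k <= n)%N -> z k x = 0) ->
  green_boundary n U z x = 0.
Proof.
by move=> z0; apply: big1 => j _; rewrite z0 ?leq_subr// !mulr0.
Qed.

(** The integral over [[b, x]] is the boundary form at [x], as the one at [b] vanishes. This form is
    integrable on the half-line, so [vanishing_integral_right] applies. *)
Lemma green_right n z U (b : R) : sobolev_jet n z ->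
  (forall k (x : R), is_derive x 1 (U k) (U k.+1 x)) ->
  (forall x, U (n.+1 + n.+1)%N x = (-1) ^+ n.+2 * U 0%N x) ->
  (forall k, sq_integrable `[b, +oo[ (U k)) ->
  (forall k, (k <= n)%N -> z k b = 0) ->
  \int[mu]_(x in `[b, +oo[) (U 0%N x * z 0%N x + U n.+1 x * z n.+1 x) = 0.
Proof.
move=> jz dU U2m sU zb; have [_ _ _ sz] := jz.
have mb : measurable `[b, +oo[%classic by exact: measurable_itv.
have szb k : (k <= n.+1)%N -> sq_integrable `[b, +oo[ (z k).
  by move=> kn; apply: sq_integrableS (sz _ kn).
apply: (vanishing_integral_right (B := green_boundary n U z)).
- by apply: integrable_EFinD => //; apply: sq_integrableM => //; exact: szb.
- exact: green_boundary_integrable.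
- move=> x; rewrite le_eqVlt => /predU1P[<-|bx].
    by rewrite set_itv1 Rintegral_set1 green_boundary0.
  by rewrite green// (@green_boundary0 n U z b)// subr0.
Qed.

Lemma green_left n z U (a : R) : sobolev_jet n z ->
  (forall k (x : R), is_derive x 1 (U k) (U k.+1 x)) ->
  (forall x, U (n.+1 + n.+1)%N x = (-1) ^+ n.+2 * U 0%N x) ->
  (forall k, sq_integrable `]-oo, a] (U k)) ->
  (forall k, (k <= n)%N -> z k a = 0) ->
  \int[mu]_(x in `]-oo, a]) (U 0%N x * z 0%N x + U n.+1 x * z n.+1 x) = 0.
Proof.
move=> jz dU U2m sU za; have [_ _ _ sz] := jz.
have ma : measurable `]-oo, a]%classic by exact: measurable_itv.
have sza k : (k <= n.+1)%N -> sq_integrable `]-oo, a] (z k).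
  by move=> kn; apply: sq_integrableS (sz _ kn).
(* The lower end of the segment now varies, hence the sign. *)
apply: (vanishing_integral_left (B := fun x => (-1) * green_boundary n U z x)).
- by apply: integrable_EFinD => //; apply: sq_integrableM => //; exact: sza.
- by apply: integrable_EFinZ => //; exact: green_boundary_integrable.
- move=> x; rewrite le_eqVlt => /predU1P[->|xa].
    by rewrite set_itv1 Rintegral_set1 green_boundary0// mulr0.
  by rewrite green// (@green_boundary0 n U z a)// sub0r mulN1r.
Qed.

(** A two-sided derivative is also the derivative relative to [[a, b]], which is unique. So the
    derivatives vanish at the endpoints too, and the boundary forms there are zero. *)
Lemma sobolev_jet_vanish n z (a b : R) : a < b -> sobolev_jet n z ->
  (forall x, a <= x -> x <= b -> z 0%N x = 0) ->
  (forall k, (k <= n)%N -> forall x, a <= x -> x <= b -> z k x = 0) /\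
  {ae mu, forall x, x \in `]a, b[ -> z n.+1 x = 0}.
Proof.
move=> ab jz z0; have [dz _ az _] := jz.
have d0 (F : R -> R) l (x : R) : (forall x, a <= x -> x <= b -> F x = 0) ->
    a <= x -> x <= b -> is_derive x 1 F l -> l = 0.
  move=> F0 ax xb dF; have xab : x \in `[a, b] by rewrite in_itv/= ax.
  rewrite -(derive_in_segment ab xab (is_derive_has_deriv_in _ dF)).
  apply: derive_in_segment => //.
  apply: eq_has_deriv_in (has_deriv_in_cst _ 0 x); first by rewrite F0.
  by move=> y; rewrite /= in_itv/= => /andP[ay yb]; rewrite F0.
have zk k : (k <= n)%N -> forall x, a <= x -> x <= b -> z k x = 0.
  elim: k => [_|k IH kn x ax xb]; first exact: z0.
  exact: d0 (IH (ltnW kn)) ax xb (dz _ kn x).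
split; first exact: zk.
apply: aeS (az _ _ ab) => x h xab; have := h xab.
by move: xab; rewrite in_itv/= => /andP[/ltW ax /ltW xb]; exact: d0 (zk n (leqnn n)) ax xb.
Qed.

End sobolev_jets.

(** * Changes of variable and splitting of the line *)

Section half_lines.
Context {R : realType}.
Notation mu := (@lebesgue_measure R).
Implicit Types F : R -> R.

Lemma sq_integrable_shift F (b : R) : continuous F ->
  sq_integrable `[0, +oo[ F -> sq_integrable `[b, +oo[ (fun x => F (x - b)).
Proof.
move=> cF [_ F2].
have cS : continuous (fun x : R => x - b) by move=> x; apply: cvgB => //; exact: cvg_cst.
have cFS : continuous (fun x => F (x - b)) by move=> x; apply: continuous_comp; [exact: cS|exact: cF].
split; first by apply: measurable_funTS; exact: continuous_measurable_fun.
have dS : derive1 (fun x : R => x - b) = cst 1.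
  by apply/funext => x; rewrite derive1E deriveB// derive_id derive_cst subr0.
have := @increasing_ge0_integration_by_substitutiony R (fun x => x - b)
  (fun x => `|F x| ^+ 2) b.
rewrite dS subrr => h.
suff <- : (\int[mu]_(x in `[0%R, +oo[) (`|F x| ^+ 2)%:E =
  \int[mu]_(x in `[b, +oo[) (`|F (x - b)| ^+ 2)%:E)%E by [].
rewrite h.
- by apply: eq_integral => x _; rewrite /= fctE/= mulr1.
- by move=> x y _ _ xy; rewrite ltrD2r.
- by move=> x _; exact: cvg_cst.
- exact: is_cvg_cst.
- exact: is_cvg_cst.
- split; first by move=> x _; apply: derivableB.
  by apply: cvg_at_right_filter; exact: cS.
- by apply: cvg_addrr.
- by apply: continuous_subspaceT => x; apply: cvgM; apply: cvg_norm; exact: cF.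
- by move=> x _; exact: sqr_ge0.
Qed.

Lemma sq_integrable_opp F (a : R) : continuous F ->
  sq_integrable `[- a, +oo[ F -> sq_integrable `]-oo, a] (fun x => F (- x)).
Proof.
move=> cF [_ F2].
have cFN : continuous (fun x => F (- x)).
  by move=> x; apply: continuous_comp; [exact: oppr_continuous|exact: cF].
split; first by apply: measurable_funTS; exact: continuous_measurable_fun.
have := @ge0_integration_by_substitutionNy R (fun x => `|F (- x)| ^+ 2) (- a).
rewrite opprK => ->.
- suff <- : (\int[mu]_(x in `[(- a)%R, +oo[) (`|F x| ^+ 2)%:E =
    \int[mu]_(x in `[(- a)%R, +oo[) (((fun x => `|F (- x)| ^+ 2) \o -%R) x)%:E)%E by [].
  by apply: eq_integral => x _; rewrite /= opprK.
- by apply: continuous_subspaceT => x; apply: cvgM; apply: cvg_norm; exact: cFN.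
- by move=> x _; exact: sqr_ge0.
Qed.

Lemma Rintegral_split3 (a b : R) (h : R -> R) : a < b -> mu.-integrable setT (EFin \o h) ->
  \int[mu]_(x in setT) h x = \int[mu]_(x in `]-oo, a]) h x +
    \int[mu]_(x in `[b, +oo[) h x + \int[mu]_(x in `]a, b[) h x.
Proof.
move=> ab inth; have mI (i : interval R) : measurable [set` i] by exact: measurable_itv.
rewrite (Rintegral_setID measurableT (mI `]-oo, a]) inth) setTI setTD -addrA.
have -> : ~` `]-oo, a]%classic = `]a, +oo[%classic by rewrite setCitvl.
congr (_ + _); rewrite (Rintegral_setID (mI `]a, +oo[) (mI `[b, +oo[)); last first.
  by apply: integrable_EFinS inth.
congr (_ + _).
  congr Rintegral; apply/setIidr => x /=; rewrite !in_itv/= !andbT; exact: lt_le_trans.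
congr Rintegral; apply/seteqP; split => x /=; rewrite !in_itv/= !andbT.
  by move=> [-> /negP]; rewrite -ltNge.
by move=> /andP[-> xb]; split => //; apply/negP; rewrite -ltNge.
Qed.

End half_lines.

(** * Orthogonality of the decaying tails *)

Section minimal_extension.
Context {R : realType}.
Notation mu := (@lebesgue_measure R).
Implicit Types (n : nat) (L U y z : nat -> R -> R).

Lemma decaying_right n (b : R) (c : nat -> R) : exists U, [/\
    forall k (x : R), is_derive x 1 (U k) (U k.+1 x),
    forall k, (k <= n)%N -> U k b = c k,
    forall x, U (n.+1 + n.+1)%N x = (-1) ^+ n.+2 * U 0%N x &
    forall k, sq_integrable `[b, +oo[ (U k)].
Proof.
have [V [dV V0 V2m V2]] := decaying_solution c (ltn0Sn n).
exists (fun k x => V k (x - b)); split.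
- move=> k x; have := @is_derive_affine R (V k) 1 (- b) x (V k.+1 (x - b)).
  by rewrite !mul1r; under eq_fun do rewrite mul1r; apply; exact: dV.
- by move=> k kn; rewrite subrr V0.
- by move=> x; exact: V2m.
- by move=> k; apply: sq_integrable_shift => //; exact: is_derive_continuous (dV k).
Qed.

(** Reflecting a right-hand tail multiplies its derivative of order [k] by [(-1) ^ k] and keeps the
    equation, whose order is even. *)
Lemma decaying_left n (a : R) (c : nat -> R) : exists L, [/\
    forall k (x : R), is_derive x 1 (L k) (L k.+1 x),
    forall k, (k <= n)%N -> L k a = c k,
    forall x, L (n.+1 + n.+1)%N x = (-1) ^+ n.+2 * L 0%N x &
    forall k, sq_integrable `]-oo, a] (L k)].
Proof.
have [V [dV V0 V2m V2]] := decaying_right n (- a) (fun k => (-1) ^+ k * c k).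
exists (fun k x => (-1) ^+ k * V k (- x)); split.
- move=> k x; have := @is_derive_affine R (V k) (-1) 0 x (V k.+1 (- x)).
  rewrite addr0 mulN1r; under eq_fun do rewrite addr0 mulN1r.
  move=> /(_ (dV _ _)) h; refine (is_derive_eq (is_deriveZ ((-1) ^+ k) h) _).
  by rewrite exprSr -mulrA.
- by move=> k kn; rewrite V0// mulrA -expr2 sqrr_sign mul1r.
- by move=> x; rewrite V2m expr0 mul1r addnn -mul2n exprM sqrrN expr1n expr1n mul1r.
- move=> k; have cV := is_derive_continuous (dV k).
  have cVN : continuous (fun x => V k (- x)).
    by move=> x; apply: continuous_comp; [exact: oppr_continuous|exact: cV].
  have /sq_integrableP[mV iV] := sq_integrable_opp cV (V2 k).
  have ma : measurable `]-oo, a]%classic by exact: measurable_itv.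
  apply: (sq_integrable_le ma _ _ iV).
    apply: measurable_funTS; apply: continuous_measurable_fun => x.
    by apply: cvgM; [exact: cvg_cst|exact: cVN].
  by move=> x _; rewrite exprMn sqrr_sign mul1r.
Qed.

(** Between [a] and [b] the integrand vanishes almost everywhere, and Green's formula settles the
    half-lines. There [y] agrees with a tail on the open half-line, hence almost everywhere on the
    closed one. *)
Lemma tails_orthogonal n (a b : R) L U y z : a < b ->
  (forall k (x : R), is_derive x 1 (L k) (L k.+1 x)) ->
  (forall k (x : R), is_derive x 1 (U k) (U k.+1 x)) ->
  (forall x, L (n.+1 + n.+1)%N x = (-1) ^+ n.+2 * L 0%N x) ->
  (forall x, U (n.+1 + n.+1)%N x = (-1) ^+ n.+2 * U 0%N x) ->
  (forall k, sq_integrable `]-oo, a] (L k)) ->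
  (forall k, sq_integrable `[b, +oo[ (U k)) ->
  (forall k (x : R), (k <= n.+1)%N -> x < a -> y k x = L k x) ->
  (forall k (x : R), (k <= n.+1)%N -> b < x -> y k x = U k x) ->
  sobolev_jet n y -> sobolev_jet n z ->
  (forall x, a <= x -> x <= b -> z 0%N x = 0) ->
  \int[mu]_(x in setT) (y 0%N x * z 0%N x + y n.+1 x * z n.+1 x) = 0.
Proof.
move=> ab dL dU L2m U2m L2 U2 yL yU [_ _ _ sy] jz z0.
have [zk zm] := sobolev_jet_vanish ab jz z0; have [_ _ _ sz] := jz.
pose h x := y 0%N x * z 0%N x + y n.+1 x * z n.+1 x.
have inth : mu.-integrable setT (EFin \o h).
  by apply: integrable_EFinD => //; apply: sq_integrableM => //; (exact: sy || exact: sz).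
have mI (i : interval R) : measurable [set` i] by exact: measurable_itv.
have mh (i : interval R) : measurable_fun [set` i] h.
  by apply: measurable_funS (measurable_integrable inth).
have szi (i : interval R) k : (k <= n.+1)%N -> sq_integrable [set` i] (z k).
  by move=> kn; apply: sq_integrableS (sz _ kn).
have aeE (i : interval R) (f : R -> R) : {ae mu, forall x, x \in i -> f x = h x} ->
    mu.-integrable [set` i] (EFin \o f) ->
    \int[mu]_(x in [set` i]) h x = \int[mu]_(x in [set` i]) f x.
  move=> fh intf; have [|//] := ae_integrable (f := f) (mI i) (mh i) _ intf.
  by apply: aeS fh => x H; rewrite inE.
rewrite (Rintegral_split3 ab inth).
rewrite (aeE _ (fun x => L 0%N x * z 0%N x + L n.+1 x * z n.+1 x)); last first.
- by apply: integrable_EFinD => //; apply: sq_integrableM => //; exact: szi.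
- apply: aeS (ae_neq a) => x xa; rewrite in_itv/= le_eqVlt (negPf xa)/= => xa'.
  by rewrite /h !yL.
rewrite (green_left jz dL L2m L2); last by move=> k kn; rewrite zk// ltW.
rewrite (aeE _ (fun x => U 0%N x * z 0%N x + U n.+1 x * z n.+1 x)); last first.
- by apply: integrable_EFinD => //; apply: sq_integrableM => //; exact: szi.
- apply: aeS (ae_neq b) => x xb; rewrite in_itv/= andbT le_eqVlt eq_sym (negPf xb)/= => xb'.
  by rewrite /h !yU.
rewrite (green_right jz dU U2m U2); last by move=> k kn; rewrite zk// ltW.
rewrite (aeE _ (fun=> 0)); last exact: integrable0.
  by rewrite Rintegral_cst_itv ?ltW// mul0r !addr0.
apply: aeS zm => x hx xab; rewrite /h hx//.
by move: xab; rewrite in_itv/= => /andP[ax xb]; rewrite z0 ?ltW// !mulr0 addr0.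
Qed.

(** If [F x] were nonzero, [|F|] would be at least [|F x| / 2] on a ball, and the integral would be
    positive. *)
Lemma continuous_Rintegral_sqr_eq0 (F : R -> R) : continuous F -> sq_integrable setT F ->
  \int[mu]_(x in setT) F x ^+ 2 = 0 -> forall x, F x = 0.
Proof.
move=> cF /sq_integrableP[_ iF] F0 x; apply/eqP; apply: contraT => Fx.
pose c := `|F x| / 2; have c0 : 0 < c by rewrite divr_gt0 ?normr_gt0.
have /cvgrPdist_lt /(_ _ c0) /nbhs_ballP[d /= d0 hd] := cF x.
pose S : set R := `]x - d, x + d[%classic.
have mS : measurable S by exact: measurable_itv.
have iS : mu.-integrable S (EFin \o (fun t => F t ^+ 2)) by exact: integrable_EFinS iF.
have muS : mu S = (2 * d)%:E.
  by rewrite (lebesgue_measure_itv_bounded false true); [congr EFin; lra|lra].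
suff : c ^+ 2 * (2 * d) <= \int[mu]_(x in setT) F x ^+ 2.
  by rewrite F0 leNgt mulr_gt0// ?exprn_gt0// mulr_gt0.
rewrite (Rintegral_setID measurableT mS iF) setTI; apply: ler_wpDr.
  by apply: Rintegral_ge0 => t _; exact: sqr_ge0.
have -> : c ^+ 2 * (2 * d) = \int[mu]_(t in S) c ^+ 2.
  by rewrite Rintegral_cst_itv; [congr (_ * _); lra|lra].
have iC : mu.-integrable S (EFin \o (fun=> c ^+ 2)).
  by apply: cst_integrable => //; rewrite [X in (X < _)%E]muS ltry.
apply: le_Rintegral => //.
move=> t; rewrite /S/= in_itv/= => /andP[xt tx].
have : ball x d t by rewrite /ball/= ltr_norml; apply/andP; split; lra.
move=> /hd/= h; have ct : c <= `|F t|.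
  have := ler_normD (F x - F t) (F t); rewrite subrK.
  by rewrite /c in h *; lra.
by rewrite -[leRHS]real_normK ?num_real// ler_pXn2r ?nnegrE// ltW.
Qed.

End minimal_extension.

(** * Minimality and uniqueness of the extension *)

Section minimal_norm.
Context {R : realType}.
Notation mu := (@lebesgue_measure R).

Definition sobolev_energy m (h : R -> R) : R :=
  \int[mu]_(x in setT) h x ^+ 2 + \int[mu]_(x in setT) derive1n m h x ^+ 2.

Lemma sobolev_normE m (h : R -> R) : sobolev_norm m h = Num.sqrt (sobolev_energy m h).
Proof.
rewrite /sobolev_norm /sobolev_energy.
have E (F : R -> R) : (fun x => `|F x| ^+ 2) = (fun x => F x ^+ 2).
  by apply/funext => x; rewrite real_normK ?num_real.
by rewrite !E.
Qed.

Lemma sobolev_energy_ge0 m (h : R -> R) : 0 <= sobolev_energy m h.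
Proof. by rewrite addr_ge0//; apply: Rintegral_ge0 => x _; exact: sqr_ge0. Qed.

Lemma pythagoras (u0 um z0 zm : R -> R) :
  sq_integrable setT u0 -> sq_integrable setT um ->
  sq_integrable setT z0 -> sq_integrable setT zm ->
  \int[mu]_(x in setT) (u0 x * z0 x + um x * zm x) = 0 ->
  \int[mu]_(x in setT) (u0 x + z0 x) ^+ 2 + \int[mu]_(x in setT) (um x + zm x) ^+ 2 =
  (\int[mu]_(x in setT) u0 x ^+ 2 + \int[mu]_(x in setT) um x ^+ 2) +
  (\int[mu]_(x in setT) z0 x ^+ 2 + \int[mu]_(x in setT) zm x ^+ 2).
Proof.
move=> su0 sum_ sz0 szm orth.
have sq (F : R -> R) : sq_integrable setT F -> mu.-integrable setT (EFin \o (fun x => F x ^+ 2)).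
  by move=> /sq_integrableP[].
have mT : measurable [set: R] by [].
have iuz := sq_integrableM mT su0 sz0; have ivz := sq_integrableM mT sum_ szm.
have E (F G : R -> R) : sq_integrable setT F -> sq_integrable setT G ->
    \int[mu]_(x in setT) (F x + G x) ^+ 2 = \int[mu]_(x in setT) F x ^+ 2 +
      2 * \int[mu]_(x in setT) (F x * G x) + \int[mu]_(x in setT) G x ^+ 2.
  move=> sF sG; have iFG := sq_integrableM mT sF sG.
  rewrite -RintegralZl// -RintegralD//; [|exact: sq|exact: integrable_EFinZ].
  rewrite -RintegralD//; last exact: sq; last first.
    by apply: integrable_EFinD => //; [exact: sq|exact: integrable_EFinZ].
  by apply: eq_Rintegral => x _; rewrite sqrrD -mulr_natl.
rewrite !E//; move: orth; rewrite RintegralD// => orth.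
by lra.
Qed.

Theorem minimal_extension n (a b : R) (g : R -> R) : a < b -> sobolev_seg n a b g ->
  exists u, [/\ sobolevR R n.+1 u, forall x, a <= x -> x <= b -> u x = g x &
    forall w, sobolevR R n.+1 w -> (forall x, a <= x -> x <= b -> w x = g x) ->
      sobolev_norm n.+1 u <= sobolev_norm n.+1 w /\
      (sobolev_norm n.+1 w <= sobolev_norm n.+1 u -> w = u)].
Proof.
move=> ab /sobolev_seg_jets[d [d0 dd rd]].
have [L [dL La L2m L2]] := decaying_left n a (fun k => d k a).
have [U [dU Ub U2m U2]] := decaying_right n b (fun k => d k b).
pose u := glue a b L d U 0; have Hu : sobolevR R n.+1 u by exact: glue_sobolevR.
have ug x : a <= x -> x <= b -> u x = g x.
  by move=> ax xb; rewrite /u /glue ltNge ax xb/= d0.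
exists u; split; [exact: Hu|exact: ug|move=> w Hw wg].
have ju := sobolevR_jet Hu; have jw := sobolevR_jet Hw.
have jz := sobolev_jetB jw ju; have [_ _ _ su] := ju; have [_ _ _ sz] := jz.
set z := (fun k x => _) in jz sz.
have orth : \int[mu]_(x in setT) (u x * z 0%N x + derive1n n.+1 u x * z n.+1 x) = 0.
  apply: (tails_orthogonal ab dL dU L2m U2m L2 U2 _ _ ju jz).
  - by move=> k x kn xa; exact: (derive1n_glue_left ab dL dU dd La Ub).
  - by move=> k x kn bx; exact: (derive1n_glue_right ab dL dU dd La Ub).
  - by move=> x ax xb; rewrite /z/= wg// ug// subrr.
have pyth : sobolev_energy n.+1 w = sobolev_energy n.+1 u +
    (\int[mu]_(x in setT) z 0%N x ^+ 2 + \int[mu]_(x in setT) z n.+1 x ^+ 2).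
  rewrite /sobolev_energy -pythagoras//; try (exact: (su 0%N)); try exact: su; try exact: sz.
  by congr (_ + _); apply: eq_Rintegral => x _; rewrite /z/= addrC subrK.
have z20 k : 0 <= \int[mu]_(x in setT) z k x ^+ 2.
  by apply: Rintegral_ge0 => x _; exact: sqr_ge0.
rewrite !sobolev_normE; split.
  by apply: ler_wsqrtr; rewrite pyth lerDl addr_ge0.
rewrite ler_sqrt ?sobolev_energy_ge0// pyth gerDl => wu.
(* The hypothesis [wu] leaves no energy for [w - u]. Its square has integral zero, so it vanishes
   everywhere by continuity. *)
have z2 : \int[mu]_(x in setT) z 0%N x ^+ 2 = 0.
  by apply/le_anti; rewrite z20 andbT; apply: le_trans wu; rewrite lerDl z20.
apply/funext => x; apply/eqP; rewrite -subr_eq0; apply/eqP.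
apply: (continuous_Rintegral_sqr_eq0 _ _ z2); [exact: sobolev_jet_continuous jz _|exact: sz].
Qed.

End minimal_norm.

(** * The vector field *)

Theorem theorem4p1 (R : realType) (m : nat) (f : R -> R) :
  (2 <= m)%N ->
  f \in sobolev01 R m ->
  (forall x : R, x \in `[0, 1] -> 0 < derive_in `[0, 1] f x) ->
  exists v : R -> R -> R,
    [/\ vector_field m v,
        forall t : R, t \in `[0, 1] -> v t \in sobolevR R m,
        forall x : R, x \in `[0, 1] ->
          [/\ lebesgue_measure.-integrable `[0, 1]
                (EFin \o (fun t : R => v t (phi f t x))),
              phi f 1 x =
                phi f 0 x + \int[lebesgue_measure]_(t in `[0, 1]) v t (phi f t x),
              f x = phi f 1 x &
              f x = x + \int[lebesgue_measure]_(t in `[0, 1]) v t (phi f t x)],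
        forall t x : R, t \in `[0, 1] -> x \in `[0, 1] ->
          [/\ v t (phi f t x) = v t (t * f x + (1 - t) * x),
              v t (phi f t x) = f x - x,
              derivable_in `[0, 1] (fun s : R => phi f s x) t &
              f x - x = derive_in `[0, 1] (fun s : R => phi f s x) t] &
        forall t : R, t \in `[0, 1] ->
          unique (min_norm_elt m [set w | w \in sobolevR R m /\ interpolates f t w])
                 (v t)].
Proof.
case: m => [|[|m]]// _ fm f'0.
(* The times are treated independently: along the flow [v t (phi f t x)] is the constant [f x - x],
   which makes the time integral explicit without regularity of [v] in [t]. *)
have /choice[v Hv] : forall t : R, exists u : R -> R, t \in `[0, 1] ->
    [/\ sobolevR R m.+2 u, interpolates f t u &
      forall w, sobolevR R m.+2 w -> interpolates f t w ->
      sobolev_norm m.+2 u <= sobolev_norm m.+2 w /\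
      (sobolev_norm m.+2 w <= sobolev_norm m.+2 u -> w = u)].
  move=> t; have [t01|] := boolP (t \in `[0, 1]); last by exists id.
  have [a [b [g [ab gab gphi phig]]]] := velocity_on_image fm f'0 t01.
  have [u [Hu ug umin]] := minimal_extension ab gab.
  exists u => _; split; [exact: Hu|move=> x x01|move=> w Hw wI].
    by have [/andP[ax xb] <-] := gphi x x01; rewrite ug.
  (* Surjectivity of [phi f t] onto [[a, b]] turns interpolation into equality with [g] there. *)
  apply: umin => // y ay yb; have [x x01 <-] := phig _ ay yb.
  by rewrite wI//; have [_ ->] := gphi x x01.
have phi1 x : phi f 1 x = f x by rewrite /phi; ring.
have phi0 x : phi f 0 x = x by rewrite /phi; ring.
have vphi t x : t \in `[0, 1] -> x \in `[0, 1] -> v t (phi f t x) = f x - x.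
  by move=> t01 x01; have [_ vI _] := Hv t t01; exact: vI.
have intv x : x \in `[0, 1] ->
    \int[lebesgue_measure]_(t in `[0, 1]) v t (phi f t x) = f x - x.
  move=> x01; rewrite -[RHS]mulr1 -[X in _ * X](subr0 1) -(Rintegral_cst_itv true false)//.
  by apply: eq_Rintegral => t; rewrite inE => t01; exact: vphi.
exists v; split.
- move=> t t01; apply/mem_set; exists 0, 0, (v t).
    by apply/mem_set; have [] := Hv t t01.
  by move=> x; rewrite mul0r !add0r.
- by move=> t t01; apply/mem_set; have [] := Hv t t01.
- move=> x x01; rewrite phi1 phi0 intv//; split=> //; try by rewrite addrC subrK.
  have icst : lebesgue_measure.-integrable `[0, 1] (EFin \o (fun=> f x - x)).
    apply: cst_integrable; first exact: measurable_itv.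
    by rewrite [X in (X < _)%E](lebesgue_measure_itv_bounded true false (@ler01 R)) ltry.
  apply: eq_integrable icst; first exact: measurable_itv.
  by move=> t; rewrite inE => t01 /=; rewrite vphi.
- move=> t x t01 x01; have dphi : has_deriv_in `[0, 1] (fun s => phi f s x) t (f x - x).
    rewrite (_ : (fun s => _) = fun s => (f x - x) * s + x); last first.
      by apply/funext => s; rewrite /phi; ring.
    apply: is_derive_has_deriv_in.
    have := is_deriveD (is_deriveZ (f x - x) (is_derive_id t 1)) (is_derive_cst x t 1).
    by rewrite addr0 [_ *: 1]mulr1.
  split => //; first exact: vphi.
  + by apply/cvg_ex; exists (f x - x).
  + by apply/esym/derive_in_segment.
- move=> t t01; have [Hu uI umin] := Hv t t01; split.
    split; first by apply/mem_set; split; [exact/mem_set|exact: uI].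
    by move=> w /set_mem[/set_mem Hw wI]; have [] := umin w Hw wI.
  (* Another minimizer has norm at most that of [v t], so the second part of [umin] identifies
     them. *)
  move=> w [/set_mem[/set_mem Hw wI] wmin]; apply/esym; have [_] := umin w Hw wI; apply.
  by apply: wmin; apply/mem_set; split; [exact/mem_set|exact: uI].
Qed.
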